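(* (1) $\mathfrak g(\mathcal A_R)$ is isomorphic to the Ramond algebra, i.e. the $d=2$, $\mathcal N=1$ superconformal algebra in the Ramond sector. (2) $\mathfrak g(\mathcal A_{\mathcal N=2})$ is isomorphic to the twisted $d=2$, $\mathcal N=2$ superconformal algebra. Here $\mathcal A_R$ and $\mathcal A_{\mathcal N=2}$ are the following Cartan data. In both, $\mathfrak h$ is the $(2|1)$-dimensional quasi-toral Lie superalgebra with odd generator $G_0$, even generators $L_0,c$, and $[G_0,G_0]=2L_0-c/12$; $\alpha\in\mathfrak t^*$ is given by $\alpha(L_0)=-1$, $\alpha(c)=0$. $\mathcal A_R$: one simple root $\alpha$; $\mathfrak g_{\pm\alpha}$ has basis $L_{\pm1}$ (even), $G_{\pm1}$ (odd) with $[G_0,L_{\pm1}]=\mp\tfrac12G_{\pm1}$, $[G_0,G_{\pm1}]=2L_{\pm1}$; and $[L_1,L_{-1}]=2L_0$, $[G_1,G_{-1}]=2L_0+c/4$, $[L_1,G_{-1}]=\tfrac32G_0=[G_1,L_{-1}]$. $\mathcal A_{\mathcal N=2}$: one simple root $\alpha/2$, so $(\alpha/2)(L_0)=-\tfrac12$, $(\alpha/2)(c)=0$; $\mathfrak g_{\pm\alpha/2}$ has basis $J_{\pm1/2}$ (even), $H_{\pm1/2}$ (odd) with $[G_0,J_{\pm1/2}]=H_{\pm1/2}$, $[G_0,H_{\pm1/2}]=\mp\tfrac12J_{\pm1/2}$; and $[J_{1/2},J_{-1/2}]=c/6$, $[J_{1/2},H_{-1/2}]=-2G_0$, $[H_{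1/2},H_{-1/2}]=2L_0$.
   Context: Everything is over $\mathbb C$. **Cartan datum.** A finite-dimensional Lie superalgebra $\mathfrak h$ is quasi-toral if $[\mathfrak h_{\bar0},\mathfrak h]=0$; $\mathfrak t=\mathfrak h_{\bar0}$. A Cartan datum consists of: such an $\mathfrak h$; a linearly independent set $\Pi\subseteq\mathfrak t^*$ of simple roots; for each $\alpha\in\pm\Pi$ a finite-dimensional $\mathfrak h$-module $\mathfrak g_\alpha$ on which $\mathfrak t$ acts by $\alpha$; and for each $\alpha\in\Pi$ a nondegenerate $\mathfrak h$-morphism $[-,-]_\alpha:\mathfrak g_\alpha\otimes\mathfrak g_{-\alpha}\to\mathfrak h$ (nonzero on $U\otimes\mathfrak g_{-\alpha}$ and $\mathfrak g_\alpha\otimes U'$ for nonzero submodules $U,U'$). $\tilde{\mathfrak g}(\mathcal A)$ is the Lie superalgebra generated by $\mathfrak h$ and all $\mathfrak g_{\pm\alpha}$, $\alpha\in\Pi$, subject to the brackets of $\mathfrak h$, $[h,x]=h\cdot x$ for $x\in\mathfrak g_{\pm\alpha}$, and $[x,y]=\delta_{\alpha\beta}[x,y]_\alpha$ for $x\in\mathfrak g_\alpha,y\in\mathfrak g_{-\beta}$, $\alpha,\beta\in\Pi$. $\mathfrak g(\mathcal A)$ is its quotient by the unique maximal ideal meeting $\mathfrak h$ trivially. **Ramond algebra.** Basis: even $L_m$ ($m\in\mathbb Z$), even central $c$, odd $G_m$ ($m\in\mathbb Z$), with $[L_m,L_n]=(m-n)L_{m+n}+\frac{c}{12}(m^3-m)\delta_{m+n,0}$,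 $[L_m,G_n]=(\frac m2-n)G_{m+n}$, $[G_m,G_n]=2L_{m+n}+\frac c3(m^2-\frac14)\delta_{m+n,0}$. **Twisted $\mathcal N=2$ algebra.** Basis: even $L_m$ ($m\in\mathbb Z$), $J_r$ ($r\in\mathbb Z+\frac12$), even central $c$; odd $G^1_m$ ($m\in\mathbb Z$), $G^2_r$ ($r\in\mathbb Z+\frac12$); with $i=\sqrt{-1}$, $[L_m,L_n]=(m-n)L_{m+n}+\frac c{12}(m^3-m)\delta_{m+n,0}$, $[L_m,J_r]=-rJ_{m+r}$, $[J_r,J_s]=\frac c3r\,\delta_{r+s,0}$, $[L_m,G^a_p]=(\frac m2-p)G^a_{m+p}$ ($a=1,2$), $[J_r,G^1_m]=iG^2_{m+r}$, $[J_r,G^2_s]=-iG^1_{r+s}$, $[G^a_p,G^a_q]=2L_{p+q}+\frac c3(p^2-\frac14)\delta_{p+q,0}$ ($a=1,2$), $[G^1_m,G^2_r]=i(m-r)J_{m+r}$.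
   Formalization: In A_{N=2} the printed [J_{1/2},H_{-1/2}]=-2G_0 and [H_{1/2},H_{-1/2}]=2L_0 do not give an h-morphism (G_0 applied to the first yields -4L_0+c/6, but 2L_0+c/12 is required); they are replaced by -G_0 and -2L_0, the values in the twisted N=2 algebra. *)

(* Defs.v *)
From HB Require Import structures.
From mathcomp Require Import all_boot all_order all_algebra generic_quotient.
From mathcomp Require Import finmap complex boolp reals monalg ring.

Set Implicit Arguments.
Unset Strict Implicit.
Unset Printing Implicit Defensive.

Import Order.TTheory GRing.Theory Num.Theory.
Local Open Scope ring_scope.
Local Open Scope quotient_scope.

(* Parities are booleans: [false] is even, [true] is odd. *)

Section Super.
Variable F : numClosedFieldType.

(* A Z/2-graded space, the grading being given by the two projections. *)
Record superSpace := SuperSpace {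
  ss_sort :> lmodType F;
  prj : bool -> ss_sort -> ss_sort;
  prj_linear : forall p, linear (prj p);
  prj_prj : forall p q x, prj p (prj q x) = if p == q then prj q x else 0;
  prj_sum : forall x, prj false x + prj true x = x
}.

Definition homog (V : superSpace) (p : bool) (x : V) : Prop := prj p x = x.

Definition fin_dim (V : superSpace) : Prop :=
  exists s : seq V, forall x : V, exists c : nat -> F,
    x = \sum_(i < size s) c i *: nth 0 s i.

Record lieSuperalgebra := LieSuperalgebra {
  lsa_space :> superSpace;
  br : lsa_space -> lsa_space -> lsa_space;
  br_linearl : forall y, linear (br^~ y);
  br_linearr : forall x, linear (br x);
  br_hom : forall p q x y, homog p x -> homog q y -> homog (p (+) q) (br x y);
  br_skew : forall p q x y, homog p x -> homog q y ->
    br x y = - ((-1) ^+ (p && q) *: br y x);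
  br_jacobi : forall p q x y z, homog p x -> homog q y ->
    br x (br y z) = br (br x y) z + (-1) ^+ (p && q) *: br y (br x z)
}.

Definition lsa_iso (L M : lieSuperalgebra) : Prop :=
  exists f : L -> M,
    [/\ linear f, bijective f,
        forall p x, f (prj p x) = prj p (f x) &
        forall x y, f (br x y) = br (f x) (f y)].

Definition quasi_toral (h : lieSuperalgebra) : Prop :=
  forall x y : h, homog false x -> br x y = 0.

Record superModule (h : lieSuperalgebra) := SuperModule {
  sm_space :> superSpace;
  act : h -> sm_space -> sm_space;
  act_linearl : forall v, linear (act^~ v);
  act_linearr : forall x, linear (act x);
  act_hom : forall p q x v, homog p x -> homog q v -> homog (p (+) q) (act x v);
  act_br : forall p q x y v, homog p x -> homog q y ->
    act (br x y) v = act x (act y v) - (-1) ^+ (p && q) *: act y (act x v)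
}.

Definition submodule (h : lieSuperalgebra) (V : superModule h) (U : V -> Prop) :=
  [/\ U 0, forall a u v, U u -> U v -> U (a *: u + v),
      forall p u, U u -> U (prj p u) & forall x u, U u -> U (act x u)].

(* Simple roots are indexed by [cd_I] (a linearly independent subset of t^* is
   finite).  An element of t^* is represented by its extension to h vanishing
   on the odd part.  [cd_mod i false] is g_alpha and [cd_mod i true] is
   g_{-alpha}, where alpha = [cd_root i]. *)
Record cartanDatum := CartanDatum {
  cd_h : lieSuperalgebra;
  cd_h_fin_dim : fin_dim cd_h;
  cd_h_quasi_toral : quasi_toral cd_h;
  cd_I : finType;
  cd_root : cd_I -> cd_h -> F;
  cd_root_linear : forall i, scalar (cd_root i);
  cd_root_odd : forall i x, homog true x -> cd_root i x = 0;
  cd_root_free : forall c : cd_I -> F,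
    (forall t, homog false t -> \sum_i c i * cd_root i t = 0) ->
    forall i, c i = 0;
  cd_mod : cd_I -> bool -> superModule cd_h;
  cd_mod_fin_dim : forall i s, fin_dim (cd_mod i s);
  cd_mod_weight : forall i s t (v : cd_mod i s), homog false t ->
    act t v = ((-1) ^+ s * cd_root i t) *: v;
  cd_pair : forall i, cd_mod i false -> cd_mod i true -> cd_h;
  cd_pair_linearl : forall i v, linear (fun u => cd_pair (i := i) u v);
  cd_pair_linearr : forall i u, linear (cd_pair (i := i) u);
  cd_pair_hom : forall i p q (u : cd_mod i false) (v : cd_mod i true),
    homog p u -> homog q v -> homog (p (+) q) (cd_pair u v);
  cd_pair_equiv : forall i p q x (u : cd_mod i false) (v : cd_mod i true),
    homog p x -> homog q u ->
    br x (cd_pair u v) =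
      cd_pair (act x u) v + (-1) ^+ (p && q) *: cd_pair u (act x v);
  cd_pair_nondegl : forall i (U : cd_mod i false -> Prop),
    submodule U -> (exists u, U u /\ u <> 0) ->
    exists u v, U u /\ cd_pair u v <> 0;
  cd_pair_nondegr : forall i (U : cd_mod i true -> Prop),
    submodule U -> (exists v, U v /\ v <> 0) ->
    exists u v, U v /\ cd_pair u v <> 0
}.

(* A Lie superalgebra up to an equivalence relation. *)
Record preLSA := PreLSA {
  pl_sort : Type;
  pl_eq : pl_sort -> pl_sort -> Prop;
  pl_zero : pl_sort;
  pl_add : pl_sort -> pl_sort -> pl_sort;
  pl_scale : F -> pl_sort -> pl_sort;
  pl_prj : bool -> pl_sort -> pl_sort;
  pl_br : pl_sort -> pl_sort -> pl_sort;
  pl_refl : forall x, pl_eq x x;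
  pl_sym : forall x y, pl_eq x y -> pl_eq y x;
  pl_trans : forall x y z, pl_eq x y -> pl_eq y z -> pl_eq x z;
  pl_addP : forall x x' y y', pl_eq x x' -> pl_eq y y' ->
    pl_eq (pl_add x y) (pl_add x' y');
  pl_scaleP : forall a x x', pl_eq x x' -> pl_eq (pl_scale a x) (pl_scale a x');
  pl_prjP : forall p x x', pl_eq x x' -> pl_eq (pl_prj p x) (pl_prj p x');
  pl_brP : forall x x' y y', pl_eq x x' -> pl_eq y y' ->
    pl_eq (pl_br x y) (pl_br x' y');
  pl_addA : forall x y z,
    pl_eq (pl_add x (pl_add y z)) (pl_add (pl_add x y) z);
  pl_addC : forall x y, pl_eq (pl_add x y) (pl_add y x);
  pl_add0 : forall x, pl_eq (pl_add pl_zero x) x;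
  pl_addN : forall x, pl_eq (pl_add (pl_scale (-1) x) x) pl_zero;
  pl_scaleA : forall a b x,
    pl_eq (pl_scale a (pl_scale b x)) (pl_scale (a * b) x);
  pl_scale1 : forall x, pl_eq (pl_scale 1 x) x;
  pl_scaleDr : forall a x y,
    pl_eq (pl_scale a (pl_add x y)) (pl_add (pl_scale a x) (pl_scale a y));
  pl_scaleDl : forall a b x,
    pl_eq (pl_scale (a + b) x) (pl_add (pl_scale a x) (pl_scale b x));
  pl_prj_linear : forall p a x y,
    pl_eq (pl_prj p (pl_add (pl_scale a x) y))
          (pl_add (pl_scale a (pl_prj p x)) (pl_prj p y));
  pl_prj_prj : forall p q x,
    pl_eq (pl_prj p (pl_prj q x)) (if p == q then pl_prj q x else pl_zero);
  pl_prj_sum : forall x, pl_eq (pl_add (pl_prj false x) (pl_prj true x)) x;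
  pl_br_linearl : forall a x y z,
    pl_eq (pl_br (pl_add (pl_scale a x) y) z)
          (pl_add (pl_scale a (pl_br x z)) (pl_br y z));
  pl_br_linearr : forall a x y z,
    pl_eq (pl_br x (pl_add (pl_scale a y) z))
          (pl_add (pl_scale a (pl_br x y)) (pl_br x z));
  pl_br_hom : forall p q x y, pl_eq (pl_prj p x) x -> pl_eq (pl_prj q y) y ->
    pl_eq (pl_prj (p (+) q) (pl_br x y)) (pl_br x y);
  pl_br_skew : forall p q x y, pl_eq (pl_prj p x) x -> pl_eq (pl_prj q y) y ->
    pl_eq (pl_br x y) (pl_scale (-1) (pl_scale ((-1) ^+ (p && q)) (pl_br y x)));
  pl_br_jacobi : forall p q x y z,
    pl_eq (pl_prj p x) x -> pl_eq (pl_prj q y) y ->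
    pl_eq (pl_br x (pl_br y z))
          (pl_add (pl_br (pl_br x y) z)
                  (pl_scale ((-1) ^+ (p && q)) (pl_br y (pl_br x z))))
}.

Section Quotient.
Variable P : preLSA.

Definition pl_rel : rel {classic pl_sort P} := fun x y => `[< pl_eq x y >].

Lemma pl_rel_refl : reflexive pl_rel.
Proof. by move=> x; apply/asboolP/pl_refl. Qed.
Lemma pl_rel_sym : symmetric pl_rel.
Proof. by move=> x y; apply/asboolP/asboolP; apply: pl_sym. Qed.
Lemma pl_rel_trans : transitive pl_rel.
Proof.
by move=> y x z /asboolP xy /asboolP yz; apply/asboolP; apply: pl_trans xy yz.
Qed.

Canonical pl_equiv := EquivRel pl_rel pl_rel_refl pl_rel_sym pl_rel_trans.

Definition quo := {eq_quot pl_equiv}.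
HB.instance Definition _ := Choice.on quo.

Definition qpi (x : pl_sort P) : quo := \pi_({eq_quot pl_equiv}) x.
Definition qrepr (x : quo) : pl_sort P := repr x.

Lemma qreprK x : qpi (qrepr x) = x. Proof. exact: reprK. Qed.

Lemma qpiP x y : qpi x = qpi y <-> pl_eq x y.
Proof.
split; first by move=> /eqmodP /asboolP.
by move=> xy; apply/eqmodP/asboolP.
Qed.

Lemma qpiW (Q : quo -> Prop) : (forall x, Q (qpi x)) -> forall x, Q x.
Proof. by move=> Qx x; rewrite -(qreprK x). Qed.

Lemma qreprP x : pl_eq (qrepr (qpi x)) x.
Proof. by apply/qpiP; rewrite qreprK. Qed.

Definition qadd x y := qpi (pl_add (qrepr x) (qrepr y)).
Definition qscale a x := qpi (pl_scale a (qrepr x)).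
Definition qprj p x := qpi (pl_prj p (qrepr x)).
Definition qbr x y := qpi (pl_br (qrepr x) (qrepr y)).

Lemma qaddE x y : qadd (qpi x) (qpi y) = qpi (pl_add x y).
Proof. by apply/qpiP/pl_addP; apply: qreprP. Qed.
Lemma qscaleE a x : qscale a (qpi x) = qpi (pl_scale a x).
Proof. by apply/qpiP/pl_scaleP/qreprP. Qed.
Lemma qprjE p x : qprj p (qpi x) = qpi (pl_prj p x).
Proof. by apply/qpiP/pl_prjP/qreprP. Qed.
Lemma qbrE x y : qbr (qpi x) (qpi y) = qpi (pl_br x y).
Proof. by apply/qpiP/pl_brP; apply: qreprP. Qed.

Lemma qaddA : associative qadd.
Proof.
elim/qpiW=> x; elim/qpiW=> y; elim/qpiW=> z; rewrite !qaddE.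
exact/qpiP/pl_addA.
Qed.
Lemma qaddC : commutative qadd.
Proof. by elim/qpiW=> x; elim/qpiW=> y; rewrite !qaddE; apply/qpiP/pl_addC. Qed.
Lemma qadd0 : left_id (qpi (pl_zero P)) qadd.
Proof. by elim/qpiW=> x; rewrite !qaddE; apply/qpiP/pl_add0. Qed.
Lemma qaddN : left_inverse (qpi (pl_zero P)) (qscale (-1)) qadd.
Proof. by elim/qpiW=> x; rewrite qscaleE !qaddE; apply/qpiP/pl_addN. Qed.

HB.instance Definition _ := GRing.isZmodule.Build quo qaddA qaddC qadd0 qaddN.

Lemma qscaleA a b x : qscale a (qscale b x) = qscale (a * b) x.
Proof. by elim/qpiW: x=> x; rewrite !qscaleE; apply/qpiP/pl_scaleA. Qed.
Lemma qscale1 : left_id 1 qscale.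
Proof. by elim/qpiW=> x; rewrite !qscaleE; apply/qpiP/pl_scale1. Qed.
Lemma qscaleDr : right_distributive qscale +%R.
Proof.
move=> a; elim/qpiW=> x; elim/qpiW=> y.
by rewrite /+%R /= qaddE !qscaleE qaddE; apply/qpiP/pl_scaleDr.
Qed.
Lemma qscaleDl x : {morph qscale^~ x : a b / a + b}.
Proof.
by elim/qpiW: x=> x a b; rewrite {2}/+%R /= !qscaleE qaddE; apply/qpiP/pl_scaleDl.
Qed.

HB.instance Definition _ :=
  GRing.Zmodule_isLmodule.Build F quo qscaleA qscale1 qscaleDr qscaleDl.

Lemma qpiD x y : qpi (pl_add x y) = qpi x + qpi y.
Proof. by rewrite -qaddE. Qed.
Lemma qpiZ a x : qpi (pl_scale a x) = a *: qpi x.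
Proof. by rewrite -qscaleE. Qed.
Lemma qpi0 : qpi (pl_zero P) = 0. Proof. by []. Qed.

Lemma qprj_linear p : linear (qprj p).
Proof.
move=> a; elim/qpiW=> x; elim/qpiW=> y.
rewrite -qpiZ -qpiD !qprjE -qpiZ -qpiD; exact/qpiP/pl_prj_linear.
Qed.
Lemma qprj_prj p q x : qprj p (qprj q x) = if p == q then qprj q x else 0.
Proof.
elim/qpiW: x => x; rewrite !qprjE -qpi0 -fun_if; exact/qpiP/pl_prj_prj.
Qed.
Lemma qprj_sum x : qprj false x + qprj true x = x.
Proof. by elim/qpiW: x => x; rewrite !qprjE -qpiD; apply/qpiP/pl_prj_sum. Qed.

Definition quo_space := SuperSpace qprj_linear qprj_prj qprj_sum.

Lemma quo_homP p x : @homog quo_space p (qpi x) <-> pl_eq (pl_prj p x) x.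
Proof. by rewrite /homog /= qprjE; apply: qpiP. Qed.

Lemma qbr_linearl y : linear (qbr^~ y).
Proof.
move=> a; elim/qpiW: y=> z; elim/qpiW=> x; elim/qpiW=> y.
rewrite -qpiZ -qpiD !qbrE -qpiZ -qpiD; exact/qpiP/pl_br_linearl.
Qed.
Lemma qbr_linearr y : linear (qbr y).
Proof.
move=> a; elim/qpiW: y=> z; elim/qpiW=> x; elim/qpiW=> y.
rewrite -qpiZ -qpiD !qbrE -qpiZ -qpiD; exact/qpiP/pl_br_linearr.
Qed.
Lemma qbr_hom p q (x y : quo_space) :
  homog p x -> homog q y -> @homog quo_space (p (+) q) (qbr x y).
Proof.
elim/qpiW: x => x; elim/qpiW: y => y /quo_homP hx /quo_homP hy.
by rewrite qbrE; apply/quo_homP/pl_br_hom.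
Qed.
Lemma qbr_skew p q (x y : quo_space) : homog p x -> homog q y ->
  qbr x y = - ((-1) ^+ (p && q) *: qbr y x).
Proof.
elim/qpiW: x => x; elim/qpiW: y => y /quo_homP hx /quo_homP hy.
rewrite -[RHS]scaleN1r !qbrE -(qpiZ _ (pl_br y x)) -(qpiZ _ (pl_scale _ _)).
by apply/qpiP; apply: pl_br_skew.
Qed.
Lemma qbr_jacobi p q (x y : quo_space) z : homog p x -> homog q y ->
  qbr x (qbr y z) = qbr (qbr x y) z + (-1) ^+ (p && q) *: qbr y (qbr x z).
Proof.
elim/qpiW: x => x; elim/qpiW: y => y /quo_homP hx /quo_homP hy.
by elim/qpiW: z => z; rewrite !qbrE -qpiZ -qpiD; apply/qpiP; apply: pl_br_jacobi.
Qed.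

Definition quoLSA :=
  @LieSuperalgebra quo_space qbr qbr_linearl qbr_linearr qbr_hom qbr_skew
    qbr_jacobi.

End Quotient.

Section Ideal.
Variable L : lieSuperalgebra.

Record ideal := Ideal {
  id_mem :> L -> Prop;
  id_0 : id_mem 0;
  id_lin : forall a x y, id_mem x -> id_mem y -> id_mem (a *: x + y);
  id_prj : forall p x, id_mem x -> id_mem (prj p x);
  id_br : forall x y, id_mem y -> id_mem (br x y)
}.

Lemma idD (I : ideal) x y : I x -> I y -> I (x + y).
Proof. by move=> Ix Iy; rewrite -[x]scale1r; apply: id_lin. Qed.
Lemma idZ (I : ideal) a x : I x -> I (a *: x).
Proof. by move=> Ix; rewrite -[_ *: _]addr0; apply: id_lin Ix (id_0 I). Qed.
Lemma idN (I : ideal) x : I x -> I (- x).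
Proof. by rewrite -scaleN1r; apply: idZ. Qed.
Lemma idB (I : ideal) x y : I x -> I y -> I (x - y).
Proof. by move=> Ix /idN; apply: idD. Qed.

Lemma prjD p (x y : L) : prj p (x + y) = prj p x + prj p y.
Proof. by have := prj_linear p 1 x y; rewrite !scale1r. Qed.
Lemma brDl (x y z : L) : br (x + y) z = br x z + br y z.
Proof. by have := br_linearl z 1 x y; rewrite !scale1r. Qed.
Lemma brDr (x y z : L) : br x (y + z) = br x y + br x z.
Proof. by have := br_linearr x 1 y z; rewrite !scale1r. Qed.
Lemma prj0 p : prj p (0 : L) = 0.
Proof. by apply: (addIr (prj p 0)); rewrite -prjD !add0r. Qed.
Lemma br0l (z : L) : br 0 z = 0.
Proof. by apply: (addIr (br 0 z)); rewrite -brDl !add0r. Qed.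
Lemma br0r (z : L) : br z 0 = 0.
Proof. by apply: (addIr (br z 0)); rewrite -brDr !add0r. Qed.
Lemma prjZ p a (x : L) : prj p (a *: x) = a *: prj p x.
Proof. by have := prj_linear p a x 0; rewrite prj0 !addr0. Qed.
Lemma brZl a (x z : L) : br (a *: x) z = a *: br x z.
Proof. by have := br_linearl z a x 0; rewrite br0l !addr0. Qed.
Lemma brZr a (x z : L) : br z (a *: x) = a *: br z x.
Proof. by have := br_linearr z a x 0; rewrite br0r !addr0. Qed.
Lemma prjN p (x : L) : prj p (- x) = - prj p x.
Proof. by rewrite -!scaleN1r prjZ. Qed.
Lemma brNl (x z : L) : br (- x) z = - br x z.
Proof. by rewrite -!scaleN1r brZl. Qed.
Lemma brNr (x z : L) : br z (- x) = - br z x.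
Proof. by rewrite -!scaleN1r brZr. Qed.
Lemma hom_prj p (x : L) : homog p (prj p x).
Proof. by rewrite /homog prj_prj eqxx. Qed.

Lemma id_brl (I : ideal) x y : I y -> I (br y x).
Proof.
move=> Iy; rewrite -(prj_sum y) -(prj_sum x) !(brDl, brDr).
do ?apply: idD; rewrite (br_skew (hom_prj _ _) (hom_prj _ _));
  by apply: idN; apply: idZ; apply: id_br; apply: id_prj.
Qed.

Section QuotientByIdeal.
Variable I : ideal.

Let R x y := I (x - y).
Let Rxx x : R x x. Proof. by rewrite /R subrr; apply: id_0. Qed.
Let Rsym x y : R x y -> R y x.
Proof. by move=> /idN; rewrite opprB. Qed.
Let Rtrans x y z : R x y -> R y z -> R x z.
Proof. by move=> xy yz; have := idD xy yz; rewrite addrA subrK. Qed.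
Let Req x y : x = y -> R x y. Proof. by move=> ->. Qed.
Let Radd x x' y y' : R x x' -> R y y' -> R (x + y) (x' + y').
Proof. by move=> xy yz; have := idD xy yz; rewrite /R opprD addrACA. Qed.
Let Rscale a x x' : R x x' -> R (a *: x) (a *: x').
Proof. by move=> xy; rewrite /R -scalerBr; apply: idZ. Qed.
Let Rprj p x x' : R x x' -> R (prj p x) (prj p x').
Proof. by move=> xy; rewrite /R -prjN -prjD; apply: id_prj. Qed.
Let Rbr x x' y y' : R x x' -> R y y' -> R (br x y) (br x' y').
Proof.
move=> xx yy; rewrite /R; have -> : br x y - br x' y' = br (x - x') y + br x' (y - y').
  by rewrite brDl brDr brNl brNr addrA subrK.
by apply: idD; [apply: id_brl|apply: id_br].
Qed.
Let Rhom p x : R (prj p x) x -> R x (prj p x). Proof. exact: Rsym. Qed.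

Definition pre_by_ideal : preLSA.
Proof.
refine (@PreLSA L R 0 +%R *:%R (@prj L) (@br L)
  Rxx Rsym Rtrans Radd Rscale Rprj Rbr _ _ _ _ _ _ _ _ _ _ _ _ _ _ _ _).
- by move=> *; apply: Req; rewrite addrA.
- by move=> *; apply: Req; rewrite addrC.
- by move=> *; apply: Req; rewrite add0r.
- by move=> *; apply: Req; rewrite scaleN1r addNr.
- by move=> *; apply: Req; rewrite scalerA.
- by move=> *; apply: Req; rewrite scale1r.
- by move=> *; apply: Req; rewrite scalerDr.
- by move=> *; apply: Req; rewrite scalerDl.
- by move=> *; apply: Req; rewrite prj_linear.
- by move=> *; apply: Req; rewrite prj_prj.
- by move=> *; apply: Req; rewrite prj_sum.
- by move=> *; apply: Req; rewrite br_linearl.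
- by move=> *; apply: Req; rewrite br_linearr.
- move=> p q x y /Rhom hx /Rhom hy.
  apply: Rtrans (Rprj _ (Rbr hx hy)) _; apply: Rsym; apply: Rtrans (Rbr hx hy) _.
  by apply: Req; rewrite (br_hom (hom_prj _ _) (hom_prj _ _)).
- move=> p q x y /Rhom hx /Rhom hy.
  apply: Rtrans (Rbr hx hy) _; apply: Rsym.
  apply: Rtrans (Rscale _ (Rscale _ (Rbr hy hx))) _.
  by apply: Req; rewrite scaleN1r (br_skew (hom_prj p x) (hom_prj q y)).
- move=> p q x y z /Rhom hx /Rhom hy.
  apply: Rtrans (Rbr hx (Rbr hy (Rxx z))) _; apply: Rsym.
  apply: Rtrans (Radd (Rbr (Rbr hx hy) (Rxx z))
                      (Rscale _ (Rbr hy (Rbr hx (Rxx z))))) _.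
  by apply: Req; rewrite (br_jacobi z (hom_prj p x) (hom_prj q y)).
Defined.

Definition quotient_by_ideal : lieSuperalgebra := quoLSA pre_by_ideal.

End QuotientByIdeal.
End Ideal.

Section Contragredient.
Variable A : cartanDatum.
Local Notation h := (cd_h A).

(* Expressions in the generators, and the congruence generated by the axioms of
   Lie superalgebras and the defining relations. *)
Inductive pterm : Type :=
  | PH (x : h)
  | PM (i : cd_I A) (s : bool) (v : cd_mod i s)
  | Padd (t u : pterm)
  | Pscale (a : F) (t : pterm)
  | Pprj (p : bool) (t : pterm)
  | Pbr (t u : pterm).

Inductive prel : pterm -> pterm -> Prop :=
  | prel_refl t : prel t t
  | prel_sym t u : prel t u -> prel u t
  | prel_trans t u v : prel t u -> prel u v -> prel t v
  | prel_congD t t' u u' : prel t t' -> prel u u' -> prel (Padd t u) (Padd t' u')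
  | prel_congZ a t t' : prel t t' -> prel (Pscale a t) (Pscale a t')
  | prel_congP p t t' : prel t t' -> prel (Pprj p t) (Pprj p t')
  | prel_congB t t' u u' : prel t t' -> prel u u' -> prel (Pbr t u) (Pbr t' u')
  | prel_addA t u v : prel (Padd t (Padd u v)) (Padd (Padd t u) v)
  | prel_addC t u : prel (Padd t u) (Padd u t)
  | prel_add0 t : prel (Padd (PH 0) t) t
  | prel_addN t : prel (Padd (Pscale (-1) t) t) (PH 0)
  | prel_scaleA a b t : prel (Pscale a (Pscale b t)) (Pscale (a * b) t)
  | prel_scale1 t : prel (Pscale 1 t) t
  | prel_scaleDr a t u :
      prel (Pscale a (Padd t u)) (Padd (Pscale a t) (Pscale a u))
  | prel_scaleDl a b t :
      prel (Pscale (a + b) t) (Padd (Pscale a t) (Pscale b t))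
  | prel_prj_linear p a t u :
      prel (Pprj p (Padd (Pscale a t) u)) (Padd (Pscale a (Pprj p t)) (Pprj p u))
  | prel_prj_prj p q t :
      prel (Pprj p (Pprj q t)) (if p == q then Pprj q t else PH 0)
  | prel_prj_sum t : prel (Padd (Pprj false t) (Pprj true t)) t
  | prel_br_linearl a t u v :
      prel (Pbr (Padd (Pscale a t) u) v) (Padd (Pscale a (Pbr t v)) (Pbr u v))
  | prel_br_linearr a t u v :
      prel (Pbr t (Padd (Pscale a u) v)) (Padd (Pscale a (Pbr t u)) (Pbr t v))
  | prel_br_hom p q t u : prel (Pprj p t) t -> prel (Pprj q u) u ->
      prel (Pprj (p (+) q) (Pbr t u)) (Pbr t u)
  | prel_br_skew p q t u : prel (Pprj p t) t -> prel (Pprj q u) u ->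
      prel (Pbr t u) (Pscale (-1) (Pscale ((-1) ^+ (p && q)) (Pbr u t)))
  | prel_br_jacobi p q t u v : prel (Pprj p t) t -> prel (Pprj q u) u ->
      prel (Pbr t (Pbr u v))
           (Padd (Pbr (Pbr t u) v) (Pscale ((-1) ^+ (p && q)) (Pbr u (Pbr t v))))
  | prel_h_linear a x y : prel (PH (a *: x + y)) (Padd (Pscale a (PH x)) (PH y))
  | prel_h_prj p x : prel (PH (prj p x)) (Pprj p (PH x))
  | prel_m_linear i s a (x y : cd_mod i s) :
      prel (PM (a *: x + y)) (Padd (Pscale a (PM x)) (PM y))
  | prel_m_prj i s p (x : cd_mod i s) : prel (PM (prj p x)) (Pprj p (PM x))
  | prel_hh x y : prel (Pbr (PH x) (PH y)) (PH (br x y))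
  | prel_hm x i s (v : cd_mod i s) : prel (Pbr (PH x) (PM v)) (PM (act x v))
  | prel_mm i (u : cd_mod i false) (v : cd_mod i true) :
      prel (Pbr (PM u) (PM v)) (PH (cd_pair u v))
  | prel_mm0 i j (u : cd_mod i false) (v : cd_mod j true) : i <> j ->
      prel (Pbr (PM u) (PM v)) (PH 0).

Definition gtilde_pre : preLSA :=
  PreLSA prel_refl prel_sym prel_trans prel_congD prel_congZ prel_congP
    prel_congB prel_addA prel_addC prel_add0 prel_addN prel_scaleA prel_scale1
    prel_scaleDr prel_scaleDl prel_prj_linear prel_prj_prj prel_prj_sum
    prel_br_linearl prel_br_linearr prel_br_hom prel_br_skew prel_br_jacobi.

Definition gtilde : lieSuperalgebra := quoLSA gtilde_pre.

Definition gt_h (x : h) : gtilde := @qpi gtilde_pre (PH x).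
Definition gt_m i s (v : cd_mod i s) : gtilde := @qpi gtilde_pre (PM v).

Definition meets_h_trivially (I : ideal gtilde) : Prop :=
  forall x : h, I (gt_h x) -> gt_h x = 0.

(* The sum of all ideals meeting h trivially; [max_idealP] below shows that it
   is the unique maximal such ideal. *)
Inductive max_ideal_mem : gtilde -> Prop :=
  | max_ideal_in (I : ideal gtilde) x :
      meets_h_trivially I -> I x -> max_ideal_mem x
  | max_ideal_add x y :
      max_ideal_mem x -> max_ideal_mem y -> max_ideal_mem (x + y).

Lemma zero_ideal : exists2 I : ideal gtilde, meets_h_trivially I & I 0.
Proof.
unshelve eexists (@Ideal gtilde (fun x => x = 0) _ _ _ _) => //=.
- by move=> a x y -> ->; rewrite scaler0 addr0.
- by move=> p x ->; apply: (@prj0 gtilde).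
- by move=> x y ->; apply: (@br0r gtilde).
Qed.

Lemma max_ideal_0 : max_ideal_mem 0.
Proof. by have [I tI I0] := zero_ideal; apply: max_ideal_in tI I0. Qed.
Lemma max_ideal_prj p x : max_ideal_mem x -> max_ideal_mem (prj p x).
Proof.
elim=> [I {}x tI Ix|{}x y _ IHx _ IHy]; last by rewrite prjD; apply: max_ideal_add.
by apply: max_ideal_in tI _; apply: id_prj.
Qed.
Lemma max_ideal_br x y : max_ideal_mem y -> max_ideal_mem (br x y).
Proof.
elim=> [I {}y tI Ix|{}y z _ IHx _ IHy]; last by rewrite brDr; apply: max_ideal_add.
by apply: max_ideal_in tI _; apply: id_br.
Qed.
Lemma max_ideal_lin a x y :
  max_ideal_mem x -> max_ideal_mem y -> max_ideal_mem (a *: x + y).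
Proof.
move=> Mx My; apply: max_ideal_add => //.
elim: Mx => [I {}x tI Ix|{}x z _ IHx _ IHy].
  by apply: max_ideal_in tI _; apply: idZ.
by rewrite scalerDr; apply: max_ideal_add.
Qed.

Definition max_ideal : ideal gtilde :=
  Ideal max_ideal_0 max_ideal_lin max_ideal_prj max_ideal_br.

Definition galg : lieSuperalgebra := quotient_by_ideal max_ideal.

Lemma gt_hD x y : gt_h (x + y) = gt_h x + gt_h y.
Proof.
have := (qpiP (P := gtilde_pre) _ _).2 (prel_h_linear 1 x y).
by rewrite scale1r (@qpiD gtilde_pre) (@qpiZ gtilde_pre) scale1r.
Qed.
Lemma gt_h0 : gt_h 0 = 0. Proof. by []. Qed.
Lemma gt_hZ a x : gt_h (a *: x) = a *: gt_h x.
Proof.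
have := (qpiP (P := gtilde_pre) _ _).2 (prel_h_linear a x 0).
rewrite addr0 (@qpiD gtilde_pre) (@qpiZ gtilde_pre).
by rewrite -[X in _ = _ + X -> _]/(gt_h 0) gt_h0 addr0.
Qed.
Lemma gt_h_prj p x : gt_h (prj p x) = prj p (gt_h x).
Proof.
rewrite -[RHS]/(@qprj gtilde_pre p (qpi _)) qprjE.
exact: (qpiP (P := gtilde_pre) _ _).2 (prel_h_prj p x).
Qed.
Lemma gt_m_lin i s a (x y : cd_mod i s) : gt_m (a *: x + y) = a *: gt_m x + gt_m y.
Proof.
have := (qpiP (P := gtilde_pre) _ _).2 (prel_m_linear a x y).
by rewrite (@qpiD gtilde_pre) (@qpiZ gtilde_pre).
Qed.
Lemma gt_mZ i s a (x : cd_mod i s) : gt_m (a *: x) = a *: gt_m x.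
Proof.
have m0 : gt_m (0 : cd_mod i s) = 0.
  have := gt_m_lin 1 (0 : cd_mod i s) 0; rewrite !scale1r addr0 => /eqP.
  by rewrite -subr_eq subrr => /eqP.
by rewrite -[a *: x]addr0 gt_m_lin m0 addr0.
Qed.
Lemma gt_m_prj i s p (x : cd_mod i s) : gt_m (prj p x) = prj p (gt_m x).
Proof.
rewrite -[RHS]/(@qprj gtilde_pre p (qpi _)) qprjE.
exact: (qpiP (P := gtilde_pre) _ _).2 (prel_m_prj p x).
Qed.
Lemma gt_hh x y : br (gt_h x) (gt_h y) = gt_h (br x y).
Proof.
rewrite -[LHS]/(@qbr gtilde_pre (qpi _) (qpi _)) qbrE.
exact: (qpiP (P := gtilde_pre) _ _).2 (prel_hh x y).
Qed.
Lemma gt_hm x i s (v : cd_mod i s) : br (gt_h x) (gt_m v) = gt_m (act x v).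
Proof.
rewrite -[LHS]/(@qbr gtilde_pre (qpi _) (qpi _)) qbrE.
exact: (qpiP (P := gtilde_pre) _ _).2 (prel_hm x v).
Qed.
Lemma gt_mm i (u : cd_mod i false) (v : cd_mod i true) :
  br (gt_m u) (gt_m v) = gt_h (cd_pair u v).
Proof.
rewrite -[LHS]/(@qbr gtilde_pre (qpi _) (qpi _)) qbrE.
exact: (qpiP (P := gtilde_pre) _ _).2 (prel_mm u v).
Qed.
Lemma gt_mm0 i j (u : cd_mod i false) (v : cd_mod j true) : i <> j ->
  br (gt_m u) (gt_m v) = 0.
Proof.
move=> ij; rewrite -[LHS]/(@qbr gtilde_pre (qpi _) (qpi _)) qbrE.
exact: (qpiP (P := gtilde_pre) _ _).2 (prel_mm0 u v ij).
Qed.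

Lemma cd_height : exists2 t0 : h, homog false t0 & forall i, cd_root i t0 = 1.
Proof.
have [s sP] := cd_h_fin_dim A.
pose f j : h := prj false (nth 0 s j).
pose M := \matrix_(i < #|cd_I A|, j < size s) cd_root (enum_val i) (f j).
have rootD i x y : cd_root i (x + y) = cd_root i x + cd_root i y :> F.
  by have := cd_root_linear i 1 x y; rewrite scale1r mul1r.
have root0 i : cd_root i 0 = 0 :> F.
  by apply: (addIr (cd_root i 0)); rewrite -rootD !add0r.
have rootZ i a x : cd_root i (a *: x) = a * cd_root i x :> F.
  by have := cd_root_linear i a x 0; rewrite root0 !addr0.
have root_sum n i (c : nat -> F) (g : nat -> h) :
    cd_root i (\sum_(j < n) c j *: g j) = \sum_(j < n) c j * cd_root i (g j).
  elim: n => [|n IH]; first by rewrite !big_ord0.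
  by rewrite !big_ord_recr /= rootD rootZ IH.
have prj_sumE n (c : nat -> F) (g : nat -> h) p :
    prj p (\sum_(j < n) c j *: g j) = \sum_(j < n) c j *: prj p (g j).
  elim: n => [|n IH]; first by rewrite !big_ord0 prj0.
  by rewrite !big_ord_recr /= prjD prjZ IH.
have freeM : row_free M.
  apply: inj_row_free => v vM0.
  pose c i := v 0 (enum_rank i).
  have c0 : forall i, c i = 0.
    apply: cd_root_free => t ht; have [d tE] := sP t.
    have -> : t = \sum_(j < size s) d j *: f j by rewrite -ht {1}tE prj_sumE.
    under eq_bigr do rewrite root_sum mulr_sumr.
    rewrite exchange_big big1 //= => j _.
    have /matrixP/(_ 0 j) := vM0; rewrite !mxE.
    rewrite (reindex enum_rank (onW_bij _ (@enum_rank_bij _))) /= => vMj.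
    rewrite -[RHS](mulr0 (d j)) -[in RHS]vMj mulr_sumr.
    by apply: eq_bigr => i _; rewrite mxE enum_rankK mulrCA.
  by apply/rowP => i; rewrite mxE -(c0 (enum_val i)) /c enum_valK.
have [N MN] := row_freeP freeM.
pose c := N *m const_mx 1 : 'cV[F]_(size s).
pose d k := if insub k is Some j then c j 0 else 0.
exists (\sum_(j < size s) d j *: f j).
  by rewrite /homog prj_sumE; apply: eq_bigr => j _; rewrite prj_prj.
move=> i; rewrite root_sum.
have : (M *m c) (enum_rank i) 0 = 1 by rewrite mulmxA MN mul1mx mxE.
rewrite mxE => <-; apply: eq_bigr => j _.
by rewrite /d valK [in RHS]mxE enum_rankK mulrC.
Qed.

Section Triangular.
Variable t0 : h.
Hypothesis t0_even : homog false t0.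
Hypothesis t0_root : forall i, cd_root i t0 = 1.

Inductive wing (s : bool) : gtilde -> Prop :=
  | wing_0 : wing s 0
  | wing_gen i (v : cd_mod i s) : wing s (gt_m v)
  | wing_lin a x y : wing s x -> wing s y -> wing s (a *: x + y)
  | wing_br i (v : cd_mod i s) x : wing s x -> wing s (br (gt_m v) x).

Definition sub_closed (tri : gtilde -> Prop) :=
  tri 0 /\ forall a x y, tri x -> tri y -> tri (a *: x + y).

Lemma sub_add tri x y : sub_closed tri -> tri x -> tri y -> tri (x + y).
Proof. by move=> [_ Sl] Sx Sy; rewrite -[x]scale1r; apply: Sl. Qed.
Lemma sub_scale tri a x : sub_closed tri -> tri x -> tri (a *: x).
Proof. by move=> [S0 Sl] Sx; rewrite -[_ *: _]addr0; apply: Sl. Qed.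
Lemma sub_opp tri x : sub_closed tri -> tri x -> tri (- x).
Proof. by rewrite -scaleN1r; apply: sub_scale. Qed.

Lemma wing_sub s : sub_closed (wing s). Proof. by split; [exact: wing_0|exact: wing_lin]. Qed.

Lemma jac_sub (tri : gtilde -> Prop) (x y z : gtilde) : sub_closed tri ->
  (forall p q, tri (br (br (prj p x) (prj q y)) z)) ->
  (forall p q, tri (br (prj q y) (br (prj p x) z))) -> tri (br x (br y z)).
Proof.
move=> sS S1 S2; rewrite -(prj_sum x) -(prj_sum y) !(brDl, brDr).
by do ?apply: sub_add => //; rewrite (br_jacobi _ (hom_prj _ _) (hom_prj _ _));
  apply: sub_add => //; apply: sub_scale.
Qed.

Lemma skew_sub (tri : gtilde -> Prop) (x y : gtilde) : sub_closed tri ->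
  (forall p q, tri (br (prj q y) (prj p x))) -> tri (br x y).
Proof.
move=> sS S1; rewrite -(prj_sum x) -(prj_sum y) !(brDl, brDr).
by do ?apply: sub_add => //; rewrite (br_skew (hom_prj _ _) (hom_prj _ _));
  apply: sub_opp => //; apply: sub_scale.
Qed.

Lemma wing_h s x u : wing s u -> wing s (br (gt_h x) u).
Proof.
move=> Uu; elim: Uu x => {u} [|i v|a u w _ IHu _ IHw|i v u Uu IHu] x.
- by rewrite br0r; apply: wing_0.
- by rewrite gt_hm; apply: wing_gen.
- by rewrite br_linearr; apply: wing_lin.
apply: jac_sub => [|p q|p q]; first exact: wing_sub.
  by rewrite -gt_h_prj -gt_m_prj gt_hm; apply: wing_br.
by rewrite -gt_h_prj -gt_m_prj; apply: wing_br.
Qed.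

Lemma wing_mh s i (v : cd_mod i s) x : wing s (br (gt_m v) (gt_h x)).
Proof.
apply: skew_sub => [|p q]; first exact: wing_sub.
by rewrite -gt_h_prj -gt_m_prj gt_hm; apply: wing_gen.
Qed.

Definition inh (x : gtilde) := exists y, x = gt_h y.
Lemma inh_sub : sub_closed inh.
Proof.
split; first by exists 0.
by move=> a x y [x' ->] [y' ->]; exists (a *: x' + y'); rewrite gt_hD gt_hZ.
Qed.

Lemma mm_inh s i j (v : cd_mod i s) (w : cd_mod j (~~ s)) :
  inh (br (gt_m v) (gt_m w)).
Proof.
have main (i' j' : cd_I A) (v' : cd_mod i' false) (w' : cd_mod j' true) :
    inh (br (gt_m v') (gt_m w')).
  case: (eqVneq i' j') => [E|/eqP ij].
    by subst j'; rewrite gt_mm; exists (cd_pair v' w').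
  by rewrite gt_mm0 //; exists 0.
case: s v w => v w; last exact: main.
apply: skew_sub => [|p q]; first exact: inh_sub.
by rewrite -!gt_m_prj; apply: main.
Qed.

Definition wingh s x := exists u y, wing s u /\ x = u + gt_h y.
Lemma wingh_sub s : sub_closed (wingh s).
Proof.
split; first by exists 0, 0; rewrite addr0; split=> //; apply: wing_0.
move=> a x y [u [z [Uu ->]]] [u' [z' [Uu' ->]]].
exists (a *: u + u'), (a *: z + z'); split; first exact: wing_lin.
by rewrite gt_hD gt_hZ scalerDr addrACA.
Qed.

Lemma wing_opp s i (v : cd_mod i s) u : wing (~~ s) u -> wingh (~~ s) (br (gt_m v) u).
Proof.
move=> Uu; elim: Uu i v => {u} [|j w|a u w _ IHu _ IHw|j w u Uu IHu] i v.
- by rewrite br0r; apply: (wingh_sub _).1.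
- have [y ->] := mm_inh v w; exists 0, y; rewrite add0r; split=> //; exact: wing_0.
- by rewrite br_linearr; apply: (wingh_sub _).2.
apply: jac_sub => [|p q|p q]; first exact: wingh_sub.
  rewrite -!gt_m_prj; have [y ->] := mm_inh (prj p v) (prj q w).
  by exists (br (gt_h y) u), 0; split; [exact: wing_h|rewrite gt_h0 addr0].
rewrite -!gt_m_prj; have [u' [y [Uu' ->]]] := IHu _ (prj p v).
exists (br (gt_m (prj q w)) u' + br (gt_m (prj q w)) (gt_h y)), 0.
split; last by rewrite gt_h0 addr0 brDr.
by apply: sub_add; [exact: wing_sub|exact: wing_br|exact: wing_mh].
Qed.

Definition tri x := exists u y w, [/\ wing true u, wing false w & x = u + gt_h y + w].
Lemma tri_sub : sub_closed tri.
Proof.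
split; first by exists 0, 0, 0; rewrite !addr0; split=> //; apply: wing_0.
move=> a x y [u [z [w [Uu Uw ->]]]] [u' [z' [w' [Uu' Uw' ->]]]].
exists (a *: u + u'), (a *: z + z'), (a *: w + w'); split; try exact: wing_lin.
by rewrite gt_hD gt_hZ !scalerDr addrACA; congr (_ + _); rewrite addrACA.
Qed.

Lemma tri_wing s x : wing s x -> tri x.
Proof.
case: s => Ux; [exists x, 0, 0|exists 0, 0, x]; rewrite gt_h0 ?addr0 ?add0r;
  by split=> //; apply: wing_0.
Qed.
Lemma tri_h x : tri (gt_h x).
Proof. by exists 0, x, 0; rewrite addr0 add0r; split=> //; apply: wing_0. Qed.
Lemma tri_wingh s x : wingh s x -> tri x.
Proof.
by move=> [u [y [Uu ->]]]; apply: sub_add; [exact: tri_sub|exact: tri_wing Uu|exact: tri_h].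
Qed.

Lemma tri_adh x z : tri z -> tri (br (gt_h x) z).
Proof.
move=> [u [y [w [Uu Uw ->]]]]; rewrite !brDr gt_hh.
do ?apply: sub_add; try exact: tri_sub; try exact: tri_h.
  by apply: tri_wing; apply: wing_h Uu.
by apply: tri_wing; apply: wing_h Uw.
Qed.

Lemma tri_adm i s (v : cd_mod i s) z : tri z -> tri (br (gt_m v) z).
Proof.
move=> [u [y [w [Uu Uw ->]]]]; rewrite !brDr.
do ?apply: sub_add; try exact: tri_sub; try exact: (tri_wing (wing_mh v y)).
  case: s v => v; first by apply: tri_wing; apply: wing_br Uu.
  by apply: tri_wingh; apply: (@wing_opp false) Uu.
case: s v => v; last by apply: tri_wing; apply: wing_br Uw.
by apply: tri_wingh; apply: (@wing_opp true) Uw.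
Qed.

Lemma prj_br r (x y : gtilde) : prj r (br x y) =
  br (prj false x) (prj r y) + br (prj true x) (prj (~~ r) y).
Proof.
rewrite -{1}(prj_sum x) -{1}(prj_sum y) !(brDl, brDr) !prjD.
have E p q : prj r (br (prj p x) (prj q y)) =
    if r == p (+) q then br (prj p x) (prj q y) else 0.
  by rewrite -(br_hom (hom_prj p x) (hom_prj q y)) prj_prj; case: eqP.
by rewrite !E; case: r {E}; rewrite /= ?addr0 ?add0r // addrC.
Qed.

Lemma tri_all x : tri x.
Proof.
have ad t p : tri (prj p (@qpi gtilde_pre t : gtilde)) /\
    forall z, tri z -> tri (br (prj p (@qpi gtilde_pre t : gtilde)) z).
  elim: t p => [y|i s v|t IHt u IHu|a t IHt|q t IHt|t IHt u IHu] p.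
  - by rewrite -[qpi _]/(gt_h y) -gt_h_prj; split; [exact: tri_h|exact: tri_adh].
  - rewrite -[qpi _]/(gt_m v) -gt_m_prj; split; last exact: tri_adm.
    by apply: tri_wing; apply: wing_gen.
  - rewrite (@qpiD gtilde_pre) prjD.
    split; first by apply: sub_add; [exact: tri_sub|exact: (IHt p).1|exact: (IHu p).1].
    move=> z Sz; rewrite brDl.
    by apply: sub_add; [exact: tri_sub|exact: (IHt p).2|exact: (IHu p).2].
  - rewrite (@qpiZ gtilde_pre) prjZ; split.
      by apply: sub_scale; [exact: tri_sub|exact: (IHt p).1].
    by move=> z Sz; rewrite brZl; apply: sub_scale; [exact: tri_sub|exact: (IHt p).2].
  - have -> : (@qpi gtilde_pre (Pprj q t) : gtilde) = prj q (@qpi gtilde_pre t : gtilde).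
      by rewrite -[RHS]/(@qprj gtilde_pre q (qpi _)) qprjE.
    rewrite prj_prj; case: eqP => _; first exact: IHt.
    by split=> [|z Sz]; rewrite ?br0l; exact: tri_sub.1.
  have -> : (@qpi gtilde_pre (Pbr t u) : gtilde) =
      br (@qpi gtilde_pre t : gtilde) (@qpi gtilde_pre u : gtilde).
    by rewrite -[RHS]/(@qbr gtilde_pre (qpi _) (qpi _)) qbrE.
  set x1 : gtilde := @qpi gtilde_pre t in IHt *.
  set x2 : gtilde := @qpi gtilde_pre u in IHu *.
  rewrite prj_br; split.
    by apply: sub_add; [exact: tri_sub|apply: (IHt _).2; exact: (IHu _).1..].
  move=> z Sz; rewrite brDl.
  have H q q' : tri (br (br (prj q x1) (prj q' x2)) z).
    have /eqP := br_jacobi z (hom_prj q x1) (hom_prj q' x2).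
    rewrite -subr_eq => /eqP <-; apply: sub_add; first exact: tri_sub.
      by apply: (IHt _).2; apply: (IHu _).2.
    apply: sub_opp; first exact: tri_sub.
    apply: sub_scale; first exact: tri_sub.
    by apply: (IHu _).2; apply: (IHt _).2.
  by apply: sub_add; [exact: tri_sub|exact: H..].
rewrite -(prj_sum x) -(@qreprK gtilde_pre x).
by apply: sub_add; [exact: tri_sub|exact: (ad _ _).1..].
Qed.

Let D (x : gtilde) : gtilde := br (gt_h t0) x.

Lemma D_hom : homog false (gt_h t0).
Proof. by rewrite /homog -gt_h_prj t0_even. Qed.
Lemma D_br x y : D (br x y) = br (D x) y + br x (D y).
Proof.
rewrite /D -(prj_sum x) !(brDl, brDr).
rewrite !(br_jacobi y D_hom (hom_prj _ x)) /= !scale1r.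
by rewrite addrACA.
Qed.
Lemma D_h x : D (gt_h x) = 0.
Proof. by rewrite /D gt_hh cd_h_quasi_toral. Qed.
Lemma D_m i s (v : cd_mod i s) : D (gt_m v) = (-1) ^+ s *: gt_m v.
Proof. by rewrite /D gt_hm cd_mod_weight // t0_root mulr1 gt_mZ. Qed.

Let step c (x : gtilde) : gtilde := D x - c *: x.
Let P r x : gtilde := foldr step x r.

Lemma step_lin c a x y : step c (a *: x + y) = a *: step c x + step c y.
Proof.
rewrite /step /D br_linearr scalerBr scalerDr opprD !scalerA addrACA.
by rewrite [c * a]mulrC.
Qed.
Lemma P_lin r a x y : P r (a *: x + y) = a *: P r x + P r y.
Proof. by elim: r => //= c r ->; rewrite step_lin. Qed.
Lemma P_add r x y : P r (x + y) = P r x + P r y.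
Proof. by have := P_lin r 1 x y; rewrite !scale1r. Qed.
Lemma P_0 r : P r 0 = 0.
Proof. by apply: (addIr (P r 0)); rewrite -P_add !add0r. Qed.
Lemma P_scale r a x : P r (a *: x) = a *: P r x.
Proof. by have := P_lin r a x 0; rewrite P_0 !addr0. Qed.
Lemma stepC c d x : step c (step d x) = step d (step c x).
Proof.
suff E c' d' : step c' (step d' x) = D (D x) - (c' + d') *: D x + (c' * d') *: x.
  by rewrite !E addrC [d + c]addrC mulrC addrC.
rewrite /step /D brDr brNr brZr scalerBr scalerA scalerDl opprB opprD -!addrA.
apply: (congr1 (+%R _)).
by rewrite [RHS]addrC addrA.
Qed.
Lemma P_step r c x : P r (step c x) = step c (P r x).
Proof. by elim: r => //= d r ->; rewrite stepC. Qed.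
Lemma P_cat r r' x : P (r ++ r') x = P r (P r' x).
Proof. exact: foldr_cat. Qed.
Lemma P_comm r r' x : P r (P r' x) = P r' (P r x).
Proof. by elim: r' => //= c r' IH; rewrite P_step IH. Qed.

Definition nonzero (r : seq F) := all (fun c => c != 0) r.
Definition killed x := exists2 r, nonzero r & P r x = 0.

Lemma killed_add x y : killed x -> killed y -> killed (x + y).
Proof.
move=> [r rn rx] [r' rn' ry]; exists (r ++ r'); first by rewrite /nonzero all_cat; apply/andP.
by rewrite P_cat P_add ry addr0 P_comm rx P_0.
Qed.

Lemma P_h r x : exists2 k : F, (nonzero r -> k != 0) & P r (gt_h x) = k *: gt_h x.
Proof.
elim: r => [|c r [k kn E]]; first by exists 1; rewrite ?oner_eq0 ?scale1r.
exists (- c * k) => /=.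
  by move=> /andP[c0 /kn k0]; rewrite mulf_neq0 ?oppr_eq0.
by rewrite E /step {1}/D brZr -/(D _) D_h scaler0 sub0r scalerA mulNr scaleNr.
Qed.

Lemma killed_h x : killed (gt_h x) -> gt_h x = 0.
Proof.
move=> [r rn]; have [k /(_ rn) k0 ->] := P_h r x.
by move=> /eqP; rewrite scaler_eq0 (negPf k0) => /eqP.
Qed.

Lemma wing_killed s x : wing s x -> killed x.
Proof.
move=> Ux; suff [r rn rx] : exists2 r,
    (forall c, c \in r -> exists n, c = (-1) ^+ s * n.+1%:R) & P r x = 0.
  exists r => //; apply/allP => c /rn [n ->].
  by rewrite mulf_neq0 ?signr_eq0 // pnatr_eq0.
elim: Ux => {x} [|i v|a x y _ [r rn rx] _ [r' rn' ry]|i v x _ [r rn rx]].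
- by exists [::].
- exists [:: (-1) ^+ s]; last by rewrite /= /step D_m subrr.
  by move=> c; rewrite inE => /eqP ->; exists 0; rewrite mulr1.
- exists (r ++ r').
    by move=> c; rewrite mem_cat => /orP[/rn|/rn'].
  by rewrite P_cat P_lin ry addr0 -P_scale P_comm P_scale rx scaler0 P_0.
exists [seq c + (-1) ^+ s | c <- r].
  move=> _ /mapP[c /rn [n ->] ->]; exists n.+1.
  by rewrite -[in RHS]natr1 mulrDr mulr1.
have <- : br (gt_m v) (P r x) = P [seq c + (-1) ^+ s | c <- r] (br (gt_m v) x).
  elim: r {rn rx} => // c r IH; set y := P r x.
  rewrite -[P (c :: r) x]/(step c y) -[RHS]/(step _ (P _ _)) -IH -/y.
  rewrite [RHS]/step D_br D_m brZl -[step c y]/(D y - c *: y).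
  rewrite brDr brNr brZr scalerDl opprD [X in _ = X + _]addrC addrACA.
  by rewrite subrr addr0.
by rewrite rx br0r.
Qed.

Lemma trivial_killed (I : ideal gtilde) x : meets_h_trivially I -> I x -> killed x.
Proof.
move=> tI Ix; have [u [y [w [/wing_killed ku /wing_killed kw xE]]]] := tri_all x.
have kuw := killed_add ku kw; have [r rn rx] := kuw.
have [k /(_ rn) k0 kE] := P_h r y.
have IP : I (P r x).
  elim: r {rn rx kE} => //= c r IH; apply: idB; last exact: idZ.
  exact: id_br.
have xE' : x = gt_h y + (u + w) by rewrite xE addrCA addrA.
have : I (gt_h y).
  rewrite -[gt_h y]scale1r -(mulVf k0) -scalerA -kE -[P r (gt_h y)]addr0 -rx.
  by rewrite -P_add -xE'; apply: idZ.
by move=> /tI y0; rewrite xE' y0 add0r.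
Qed.

Lemma max_killed x : max_ideal x -> killed x.
Proof.
by elim=> [I {}x|{}x y _ kx _ ky]; [exact: trivial_killed|exact: killed_add].
Qed.

End Triangular.

Theorem max_idealP : meets_h_trivially max_ideal /\
  forall I : ideal gtilde, meets_h_trivially I -> forall x, I x -> max_ideal x.
Proof.
split=> [x|I tI x Ix]; last exact: max_ideal_in tI Ix.
have [t0 t0_even t0_root] := cd_height.
by move=> /(max_killed t0_even t0_root) /killed_h; apply.
Qed.

End Contragredient.
End Super.

Section Free.
Variables (F : numClosedFieldType) (K : choiceType).

Definition bas (k : K) : {malg F[K]} := << k >>.

Definition lin (V : lmodType F) (f : K -> V) (x : {malg F[K]}) : V :=
  \sum_(k <- msupp x) x@_k *: f k.

Lemma linEw (V : lmodType F) (f : K -> V) (d : {fset K}) x :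
  (msupp x `<=` d)%fset -> lin f x = \sum_(k <- d) x@_k *: f k.
Proof.
move=> le; rewrite /lin [RHS](big_fsetID _ [in msupp x]) /=.
rewrite [X in _ + X]big1_fset ?addr0; last first.
  move=> k; rewrite in_fset inE /= => /andP[_ kx] _.
  by rewrite mcoeff_outdom ?scale0r.
apply: eq_fbigl => k; rewrite in_fset inE /=.
by case: (boolP (k \in msupp x)) => kx; rewrite ?andbF ?andbT // (fsubsetP le).
Qed.

Lemma lin_linear (V : lmodType F) (f : K -> V) : linear (lin f).
Proof.
move=> a x y; set d := (msupp (a *: x + y) `|` (msupp x `|` msupp y))%fset.
rewrite (@linEw _ _ d (_ + _)) ?fsubsetUl //.
rewrite (@linEw _ _ d x); last by rewrite /d fsetUCA fsubsetUl.
rewrite (@linEw _ _ d y); last by rewrite /d fsetUA fsubsetUr.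
rewrite scaler_sumr -big_split /=; apply: eq_bigr => k _.
by rewrite mcoeffD mcoeffZ scalerDl scalerA.
Qed.

HB.instance Definition _ (V : lmodType F) (f : K -> V) :=
  GRing.isLinear.Build F {malg F[K]} V *:%R (lin f) (@lin_linear V f).

Lemma lin_add (V : lmodType F) (f : K -> V) x y : lin f (x + y) = lin f x + lin f y.
Proof. exact: linearD. Qed.
Lemma lin_opp (V : lmodType F) (f : K -> V) x : lin f (- x) = - lin f x.
Proof. exact: linearN. Qed.
Lemma lin_scale (V : lmodType F) (f : K -> V) a x : lin f (a *: x) = a *: lin f x.
Proof. exact: linearZ. Qed.
Lemma lin_zero (V : lmodType F) (f : K -> V) : lin f 0 = 0.
Proof. exact: linear0. Qed.

Lemma coef_add (x y : {malg F[K]}) z : (x + y)@_z = x@_z + y@_z.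
Proof. exact: mcoeffD. Qed.
Lemma coef_opp (x : {malg F[K]}) z : (- x)@_z = - x@_z.
Proof. exact: mcoeffN. Qed.
Lemma coef_scale a (x : {malg F[K]}) z : (a *: x)@_z = a * x@_z.
Proof. exact: mcoeffZ. Qed.
Lemma coef_zero z : (0 : {malg F[K]})@_z = 0.
Proof. exact: mcoeff0. Qed.

Lemma lin_bas (V : lmodType F) (f : K -> V) k : lin f (bas k) = f k.
Proof. by rewrite /lin /bas msuppU oner_eq0 big_seq_fset1 mcoeffUU scale1r. Qed.

Lemma bas_coef k l : (bas k)@_l = (k == l)%:R.
Proof. by rewrite mcoeffU. Qed.

Lemma bas_neq0 a k : a != 0 -> a *: bas k != 0.
Proof.
move=> a0; apply/eqP => /(congr1 (mcoeff k)).
by rewrite mcoeffZ bas_coef eqxx mulr1 mcoeff0; apply/eqP.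
Qed.

Lemma bas_sum x : x = \sum_(k <- msupp x) x@_k *: bas k.
Proof.
apply/malgP => l; rewrite raddf_sum /= {1}(monalgE x) raddf_sum /=.
by apply: eq_bigr => k _; rewrite mcoeffZ bas_coef mcoeffU mulr_natr.
Qed.

Lemma bas_ext (V : lmodType F) (f g : {malg F[K]} -> V) :
  linear f -> linear g -> (forall k, f (bas k) = g (bas k)) -> f =1 g.
Proof.
move=> lf lg fg x.
have sumE (u : {malg F[K]} -> V) : linear u ->
    forall r : seq K, u (\sum_(k <- r) x@_k *: bas k) = \sum_(k <- r) x@_k *: u (bas k).
  move=> lu; elim=> [|k r IH].
    rewrite !big_nil; have := lu 1 0 0; rewrite !scale1r addr0 => /eqP.
    by rewrite -subr_eq subrr => /eqP.
  by rewrite !big_cons lu IH.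
by rewrite (bas_sum x) !sumE //; apply: eq_bigr => k _; rewrite fg.
Qed.

Variable par : K -> bool.

Definition free_prj p : {malg F[K]} -> {malg F[K]} :=
  lin (fun k => if par k == p then bas k else 0).

Lemma free_prj_bas p k : free_prj p (bas k) = if par k == p then bas k else 0.
Proof. by rewrite /free_prj lin_bas. Qed.
Lemma free_prj_linear p : linear (free_prj p). Proof. exact: linearP. Qed.
Lemma free_prj_prj p q x :
  free_prj p (free_prj q x) = if p == q then free_prj q x else 0.
Proof.
apply: (bas_ext (f := free_prj p \o free_prj q)
                (g := fun x => if p == q then free_prj q x else 0)).
- by move=> a u v /=; rewrite !free_prj_linear.
- by move=> a u v; case: eqP => _; rewrite ?free_prj_linear // scaler0 addr0.
move=> k /=; rewrite free_prj_bas (fun_if (free_prj p)) free_prj_bas /free_prj raddf0.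
by case: p; case: q; case: (par k).
Qed.
Lemma free_prj_sum x : free_prj false x + free_prj true x = x.
Proof.
apply: (bas_ext (f := fun x => free_prj false x + free_prj true x) (g := id)) => //.
  by move=> a u v; rewrite !free_prj_linear scalerDr addrACA.
by move=> k; rewrite !free_prj_bas; case: (par k); rewrite ?addr0 ?add0r.
Qed.

Definition free_space :=
  @SuperSpace F {malg F[K]} free_prj free_prj_linear free_prj_prj free_prj_sum.

Lemma free_hom_ext (V : lmodType F) (f g : free_space -> V) p :
  linear f -> linear g -> (forall k, par k = p -> f (bas k) = g (bas k)) ->
  forall x, homog p x -> f x = g x.
Proof.
move=> lf lg fg x <-.
apply: (bas_ext (f := f \o free_prj p) (g := g \o free_prj p)).
- by move=> a u v /=; rewrite free_prj_linear lf.
- by move=> a u v /=; rewrite free_prj_linear lg.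
move=> k /=; rewrite free_prj_bas; case: eqP => [/fg//|_].
have lin0 (u : {malg F[K]} -> V) : linear u -> u 0 = 0.
  move=> lu; have := lu 1 0 0; rewrite !scale1r addr0 => /eqP.
  by rewrite -subr_eq subrr => /eqP.
by rewrite !lin0.
Qed.

Lemma free_fin_dim (s : seq K) : uniq s -> (forall k, k \in s) ->
  fin_dim free_space.
Proof.
move=> us sK; exists [seq bas k | k <- s] => x.
case: s us sK => [|k0 s] us sK.
  exists (fun=> 0); rewrite big_ord0; apply/malgP => k.
  by have := sK k; rewrite in_nil.
exists (fun i => x@_(nth k0 (k0 :: s) i)).
rewrite size_map -(big_mkord predT (fun i => x@_(nth k0 (k0 :: s) i)
  *: nth 0 [seq bas k | k <- k0 :: s] i)) big_nat.
rewrite (eq_bigr (fun i => x@_(nth k0 (k0 :: s) i) *: bas (nth k0 (k0 :: s) i)));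
  last by move=> i /andP[_ ls]; rewrite (nth_map k0).
rewrite -big_nat -(big_nth k0 predT (fun k => x@_k *: bas k)).
apply/malgP => k; rewrite raddf_sum /= (bigD1_seq k) //= mcoeffZ bas_coef eqxx.
rewrite mulr1 big1 ?addr0 // => j /negPf jk.
by rewrite mcoeffZ bas_coef jk mulr0.
Qed.

End Free.

Definition bilin (F : numClosedFieldType) (K J : choiceType) (V : lmodType F)
    (t : K -> J -> V) (x : {malg F[K]}) (y : {malg F[J]}) : V :=
  lin (fun k => lin (t k) y) x.

Lemma bilin_linearl (F : numClosedFieldType) (K J : choiceType) (V : lmodType F)
  (t : K -> J -> V) y : linear (fun x => bilin t x y).
Proof. exact: lin_linear. Qed.

Lemma bilin_linearr (F : numClosedFieldType) (K J : choiceType) (V : lmodType F)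
  (t : K -> J -> V) x : linear (bilin t x).
Proof.
have E z : bilin t x z = \sum_(k <- msupp x) x@_k *: lin (t k) z by [].
move=> a u v; rewrite !E scaler_sumr -big_split /=.
by apply: eq_bigr => k _; rewrite lin_linear scalerDr scalerA mulrC -scalerA.
Qed.

Lemma bilin_bas (F : numClosedFieldType) (K J : choiceType) (V : lmodType F)
  (t : K -> J -> V) k j : bilin t (bas F k) (bas F j) = t k j.
Proof. by rewrite /bilin !lin_bas. Qed.

Lemma bilin_basl (F : numClosedFieldType) (K J : choiceType) (V : lmodType F)
  (t : K -> J -> V) k x : bilin t (bas F k) x = lin (t k) x.
Proof. by rewrite /bilin !lin_bas. Qed.

Lemma bilin_basr (F : numClosedFieldType) (K J : choiceType) (V : lmodType F)
  (t : K -> J -> V) k x : bilin t x (bas F k) = lin (t^~ k) x.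
Proof. by apply: eq_bigr => j _; rewrite lin_bas. Qed.

(* The Lie superalgebra with basis [K], parity [par] and multiplication table
   [t]. *)
Section Table.
Variables (F : numClosedFieldType) (K : choiceType) (par : K -> bool).
Variable t : K -> K -> {malg F[K]}.
Hypothesis t_hom : forall k l, @homog F (free_space F par) (par k (+) par l) (t k l).
Hypothesis t_skew : forall k l, t k l = - ((-1) ^+ (par k && par l) *: t l k).
Hypothesis t_jacobi : forall k l m,
  bilin t (bas F k) (bilin t (bas F l) (bas F m)) =
    bilin t (bilin t (bas F k) (bas F l)) (bas F m)
    + (-1) ^+ (par k && par l) *:
        bilin t (bas F l) (bilin t (bas F k) (bas F m)).

Local Notation V := (free_space F par).

Lemma table_hom p q (x y : V) : homog p x -> homog q y ->
  @homog F V (p (+) q) (bilin t x y).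
Proof.
move=> hx hy; move: x hx; apply: (free_hom_ext (g := (bilin t)^~ y)).
- by move=> a u v; rewrite bilin_linearl; apply: free_prj_linear.
- exact: bilin_linearl.
move=> k pk; move: y hy; apply: (free_hom_ext (g := bilin t (bas F k))).
- by move=> a u v; rewrite bilin_linearr; apply: free_prj_linear.
- exact: bilin_linearr.
by move=> l pl; rewrite bilin_bas -pk -pl; apply: t_hom.
Qed.

Lemma table_skew p q (x y : V) : homog p x -> homog q y ->
  bilin t x y = - ((-1) ^+ (p && q) *: bilin t y x).
Proof.
move=> hx hy; move: x hx; apply: free_hom_ext.
- exact: bilin_linearl.
- move=> a u v; rewrite bilin_linearr scalerDr opprD scalerN !scalerA.
  by rewrite [a * _]mulrC.
move=> k pk; move: y hy; apply: free_hom_ext.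
- exact: bilin_linearr.
- move=> a u v; rewrite bilin_linearl scalerDr opprD scalerN !scalerA.
  by rewrite [a * _]mulrC.
by move=> l pl; rewrite !bilin_bas -pk -pl; apply: t_skew.
Qed.

Lemma table_jacobi p q (x y : V) z : homog p x -> homog q y ->
  bilin t x (bilin t y z) =
    bilin t (bilin t x y) z + (-1) ^+ (p && q) *: bilin t y (bilin t x z).
Proof.
move=> hx hy; move: x hx; apply: free_hom_ext.
- exact: bilin_linearl.
- move=> a u v; rewrite !bilin_linearl bilin_linearr.
  rewrite !scalerDr addrACA !scalerA.
  by rewrite [a * _]mulrC.
move=> k pk; move: y hy; apply: free_hom_ext.
- by move=> a u v; rewrite bilin_linearl bilin_linearr.
- move=> a u v; rewrite bilin_linearr !bilin_linearl.
  rewrite !scalerDr addrACA !scalerA.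
  by rewrite [a * _]mulrC.
move=> l pl; move: z; apply: bas_ext.
- by move=> a u v; rewrite !bilin_linearr.
- move=> a u v; rewrite !bilin_linearr.
  rewrite !scalerDr addrACA !scalerA.
  by rewrite [a * _]mulrC.
by move=> m; rewrite -pk -pl; apply: t_jacobi.
Qed.

Definition tableLSA : lieSuperalgebra F :=
  @LieSuperalgebra F V (bilin t) (fun y => bilin_linearl t y)
    (fun x => bilin_linearr t x) table_hom table_skew table_jacobi.

End Table.

Section Bilinear.
Variables (F : numClosedFieldType) (V1 V2 V : lmodType F).
Variables (B : V1 -> V2 -> V) (phi : V -> F).
Hypothesis Bl : forall y, linear (B^~ y).
Hypothesis Br : forall x, linear (B x).
Hypothesis phil : scalar phi.

Lemma bl0l y : B 0 y = 0.
Proof.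
by have := Bl y 1 0 0; rewrite !scale1r addr0 => /eqP; rewrite -subr_eq subrr => /eqP.
Qed.
Lemma bl0r y : B y 0 = 0.
Proof.
by have := Br y 1 0 0; rewrite !scale1r addr0 => /eqP; rewrite -subr_eq subrr => /eqP.
Qed.
Lemma bl0p : phi 0 = 0.
Proof.
by have := phil 1 0 0; rewrite scale1r mul1r addr0 => /eqP; rewrite -subr_eq subrr => /eqP.
Qed.
Lemma blDl x y z : B (x + y) z = B x z + B y z.
Proof. by have := Bl z 1 x y; rewrite !scale1r. Qed.
Lemma blDr x y z : B z (x + y) = B z x + B z y.
Proof. by have := Br z 1 x y; rewrite !scale1r. Qed.
Lemma blDp x y : phi (x + y) = phi x + phi y.
Proof. by have := phil 1 x y; rewrite scale1r mul1r. Qed.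
Lemma blZl a x z : B (a *: x) z = a *: B x z.
Proof. by have := Bl z a x 0; rewrite bl0l !addr0. Qed.
Lemma blZr a x z : B z (a *: x) = a *: B z x.
Proof. by have := Br z a x 0; rewrite bl0r !addr0. Qed.
Lemma blZp a x : phi (a *: x) = a * phi x.
Proof. by have := phil a x 0; rewrite bl0p !addr0. Qed.
Lemma blNl x z : B (- x) z = - B x z.
Proof. by rewrite -!scaleN1r blZl. Qed.
Lemma blNr x z : B z (- x) = - B z x.
Proof. by rewrite -!scaleN1r blZr. Qed.
Lemma blNp x : phi (- x) = - phi x.
Proof. by rewrite -scaleN1r blZp mulN1r. Qed.
End Bilinear.

Section Ramond.
Variable F : numClosedFieldType.

Inductive ramond_index := RL of int | RG of int | RC.
HB.instance Definition _ := gen_eqMixin ramond_index.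
HB.instance Definition _ := gen_choiceMixin ramond_index.

Definition ramond_par (k : ramond_index) : bool :=
  if k is RG _ then true else false.

Definition ramond_table (V : lmodType F) (e : ramond_index -> V)
    (x y : ramond_index) : V :=
  match x, y with
  | RL m, RL n => (m - n)%:~R *: e (RL (m + n))
      + ((m ^+ 3 - m)%:~R / 12 * (m + n == 0)%:R) *: e RC
  | RL m, RG n => (m%:~R / 2 - n%:~R) *: e (RG (m + n))
  | RG m, RL n => - ((n%:~R / 2 - m%:~R) *: e (RG (n + m)))
  | RG m, RG n => 2 *: e (RL (m + n))
      + ((m%:~R ^+ 2 - 1 / 4) / 3 * (m + n == 0)%:R) *: e RC
  | RC, _ | _, RC => 0
  end.

Section Check.
Variables (V : lmodType F) (e : ramond_index -> V).
Variables (B : V -> V -> V) (phi : V -> F).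
Hypothesis Bl : forall y, linear (B^~ y).
Hypothesis Br : forall x, linear (B x).
Hypothesis phil : scalar phi.
Hypothesis Be : forall x y, B (e x) (e y) = ramond_table e x y.

Let BE := (blDl Bl, blDr Br, blZl Bl, blZr Br, blNl Bl, blNr Br, bl0l Bl, bl0r Br).
Let phiE := (blDp phil, blZp phil, blNp phil, bl0p phil).

Ltac idx s :=
  repeat match goal with
  | |- context [RL ?i] => tryif constr_eq i s then fail else
       (replace (RL i) with (RL s) by (congr RL; ring))
  | |- context [RG ?i] => tryif constr_eq i s then fail else
       (replace (RG i) with (RG s) by (congr RG; ring))
  | |- context [@eq_op _ ?i 0] => tryif constr_eq i s then fail else
       (replace i with s by ring)
  end.
Ltac phi_field s v w :=
  rewrite ?phiE; idx s;
  generalize (phi (e (RL s))) (phi (e (RG s))) (phi (e RC));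
  intros ? ? ?;
  let H := fresh in
  case: (s =P 0) => [H|_] /=;
  [ have -> : v = w by (rewrite -[LHS]subr0 -H; ring) | ]; field; done.

Lemma ramond_skew_phi k l : phi (ramond_table e k l) =
  phi (- ((-1) ^+ (ramond_par k && ramond_par l) *: ramond_table e l k)).
Proof.
case: k => [m|m|]; case: l => [n|n|] /=;
  first [ by rewrite ?phiE ?mulr0 ?oppr0 | phi_field (m + n) n (- m) ].
Qed.

Lemma ramond_jacobi_phi j k l : phi (B (e j) (B (e k) (e l))) =
  phi (B (B (e j) (e k)) (e l)
    + (-1) ^+ (ramond_par j && ramond_par k) *: B (e k) (B (e j) (e l))).
Proof.
rewrite !Be; case: j => [m|m|]; case: k => [n|n|]; case: l => [r|r|] /=;
  rewrite ?(BE, Be) /= ?phiE;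
  first [ by rewrite ?(mulr0, oppr0, addr0) | phi_field (m + n + r) r (- m - n) ].
Qed.
End Check.

Local Notation e := (@bas F ramond_index).
Let mcoeff_scalar z : scalar (@mcoeff ramond_index F z).
Proof. by move=> a x y; rewrite mcoeffD mcoeffZ. Qed.

Lemma ramond_hom k l : @homog F (free_space F ramond_par)
  (ramond_par k (+) ramond_par l) (ramond_table e k l).
Proof.
rewrite /homog /=; case: k => [m|m|]; case: l => [n|n|] /=;
by rewrite /free_prj ?(lin_add, lin_opp, lin_scale, lin_zero) /= ?lin_bas /= ?scaler0.
Qed.

Lemma ramond_skew k l : ramond_table e k l =
  - ((-1) ^+ (ramond_par k && ramond_par l) *: ramond_table e l k).
Proof. by apply/malgP => z; apply: (ramond_skew_phi e (mcoeff_scalar z)). Qed.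

Lemma ramond_jacobi j k l : let B := bilin (ramond_table e) in
  B (e j) (B (e k) (e l)) = B (B (e j) (e k)) (e l)
    + (-1) ^+ (ramond_par j && ramond_par k) *: B (e k) (B (e j) (e l)).
Proof.
move=> B; apply/malgP => z; apply: ramond_jacobi_phi (mcoeff_scalar z) _ _ _ _.
- exact: bilin_linearl.
- exact: bilin_linearr.
by move=> x y; apply: bilin_bas.
Qed.

Definition ramond : lieSuperalgebra F :=
  tableLSA ramond_hom ramond_skew ramond_jacobi.

End Ramond.

Section TwistedN2.
Variable F : numClosedFieldType.

(* [NJ k] and [NG2 k] stand for J_r and G^2_r with r = k + 1/2. *)
Inductive n2_index := NL of int | NJ of int | NG1 of int | NG2 of int | NC.
HB.instance Definition _ := gen_eqMixin n2_index.
HB.instance Definition _ := gen_choiceMixin n2_index.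

Definition n2_par (k : n2_index) : bool :=
  match k with NG1 _ | NG2 _ => true | _ => false end.

Definition half (k : int) : F := k%:~R + 1 / 2.

Definition n2_table (V : lmodType F) (e : n2_index -> V) (x y : n2_index) : V :=
  match x, y with
  | NL m, NL n => (m - n)%:~R *: e (NL (m + n))
      + ((m ^+ 3 - m)%:~R / 12 * (m + n == 0)%:R) *: e NC
  | NL m, NJ k => - half k *: e (NJ (m + k))
  | NJ k, NL m => - (- half k *: e (NJ (m + k)))
  | NJ k, NJ l => (half k / 3 * (k + l + 1 == 0)%:R) *: e NC
  | NL m, NG1 n => (m%:~R / 2 - n%:~R) *: e (NG1 (m + n))
  | NG1 n, NL m => - ((m%:~R / 2 - n%:~R) *: e (NG1 (m + n)))
  | NL m, NG2 k => (m%:~R / 2 - half k) *: e (NG2 (m + k))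
  | NG2 k, NL m => - ((m%:~R / 2 - half k) *: e (NG2 (m + k)))
  | NJ k, NG1 m => 'i *: e (NG2 (m + k))
  | NG1 m, NJ k => - ('i *: e (NG2 (m + k)))
  | NJ k, NG2 l => - 'i *: e (NG1 (k + l + 1))
  | NG2 l, NJ k => - (- 'i *: e (NG1 (k + l + 1)))
  | NG1 m, NG1 n => 2 *: e (NL (m + n))
      + ((m%:~R ^+ 2 - 1 / 4) / 3 * (m + n == 0)%:R) *: e NC
  | NG2 k, NG2 l => 2 *: e (NL (k + l + 1))
      + ((half k ^+ 2 - 1 / 4) / 3 * (k + l + 1 == 0)%:R) *: e NC
  | NG1 m, NG2 k | NG2 k, NG1 m => ('i * (m%:~R - half k)) *: e (NJ (m + k))
  | NC, _ | _, NC => 0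
  end.

Section Check.
Variables (V : lmodType F) (e : n2_index -> V).
Variables (B : V -> V -> V) (phi : V -> F).
Hypothesis Bl : forall y, linear (B^~ y).
Hypothesis Br : forall x, linear (B x).
Hypothesis phil : scalar phi.
Hypothesis Be : forall x y, B (e x) (e y) = n2_table e x y.

Let BE := (blDl Bl, blDr Br, blZl Bl, blZr Br, blNl Bl, blNr Br, bl0l Bl, bl0r Br).
Let phiE := (blDp phil, blZp phil, blNp phil, bl0p phil).
Let ii : 'i ^+ 2 = -1 :> F := sqrCi F.

Ltac idx s :=
  repeat match goal with
  | |- context [NL ?i] => tryif constr_eq i s then fail else
       (replace (NL i) with (NL s) by (congr NL; ring))
  | |- context [NJ ?i] => tryif constr_eq i s then fail else
       (replace (NJ i) with (NJ s) by (congr NJ; ring))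
  | |- context [NG1 ?i] => tryif constr_eq i s then fail else
       (replace (NG1 i) with (NG1 s) by (congr NG1; ring))
  | |- context [NG2 ?i] => tryif constr_eq i s then fail else
       (replace (NG2 i) with (NG2 s) by (congr NG2; ring))
  | |- context [@eq_op _ ?i 0] => tryif constr_eq i s then fail else
       (replace i with s by ring)
  end.
Ltac phi_field s v w :=
  rewrite ?phiE; idx s;
  generalize (phi (e (NL s))) (phi (e (NJ s))) (phi (e (NG1 s)))
    (phi (e (NG2 s))) (phi (e NC));
  intros ? ? ? ? ?; rewrite /half;
  let H := fresh in
  case: (s =P 0) => [H|_] /=;
  [ (have {}H : v = w by (rewrite -[LHS]subr0 -H; ring)); rewrite ?{}H | ];
  field: ii; done.

Lemma n2_skew_phi k l : phi (n2_table e k l) =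
  phi (- ((-1) ^+ (n2_par k && n2_par l) *: n2_table e l k)).
Proof.
case: k => [m|m|m|m|]; case: l => [n|n|n|n|] /=;
  first [ by rewrite ?phiE ?mulr0 ?oppr0
        | phi_field (m + n) n (- m)
        | phi_field (m + n + 1) n (- m - 1)].
Qed.

Lemma n2_jacobi_phi j k l : phi (B (e j) (B (e k) (e l))) =
  phi (B (B (e j) (e k)) (e l)
    + (-1) ^+ (n2_par j && n2_par k) *: B (e k) (B (e j) (e l))).
Proof.
rewrite !Be; case: j => [m|m|m|m|]; case: k => [n|n|n|n|]; case: l => [r|r|r|r|] /=;
  rewrite ?(BE, Be) /= ?phiE;
  first [ by rewrite ?(mulr0, oppr0, addr0)
        | phi_field (m + n + r) r (- m - n)
        | phi_field (m + n + r + 1) r (- m - n - 1)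
        | phi_field (m + n + r + 2) r (- m - n - 2) ].
Qed.
End Check.

Local Notation e := (@bas F n2_index).
Let mcoeff_scalar z : scalar (@mcoeff n2_index F z).
Proof. by move=> a x y; rewrite mcoeffD mcoeffZ. Qed.

Lemma n2_hom k l : @homog F (free_space F n2_par)
  (n2_par k (+) n2_par l) (n2_table e k l).
Proof.
rewrite /homog /=; case: k => [m|m|m|m|]; case: l => [n|n|n|n|] /=;
by rewrite /free_prj ?(lin_add, lin_opp, lin_scale, lin_zero) /= ?lin_bas /= ?scaler0.
Qed.

Lemma n2_skew k l : n2_table e k l =
  - ((-1) ^+ (n2_par k && n2_par l) *: n2_table e l k).
Proof. by apply/malgP => z; apply: (n2_skew_phi e (mcoeff_scalar z)). Qed.

Lemma n2_jacobi j k l : let B := bilin (n2_table e) in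
  B (e j) (B (e k) (e l)) = B (B (e j) (e k)) (e l)
    + (-1) ^+ (n2_par j && n2_par k) *: B (e k) (B (e j) (e l)).
Proof.
move=> B; apply/malgP => z; apply: n2_jacobi_phi (mcoeff_scalar z) _ _ _ _.
- exact: bilin_linearl.
- exact: bilin_linearr.
by move=> x y; apply: bilin_bas.
Qed.

Definition twistedN2 : lieSuperalgebra F := tableLSA n2_hom n2_skew n2_jacobi.

End TwistedN2.

Section QuasiToral.
Variable F : numClosedFieldType.

Inductive h_index := HG | HL | HC.
HB.instance Definition _ := gen_eqMixin h_index.
HB.instance Definition _ := gen_choiceMixin h_index.

Definition h_par (k : h_index) : bool := if k is HG then true else false.

Definition h_gen_table (V : lmodType F) (e : h_index -> V) (x y : h_index) : V :=
  match x, y with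
  | HG, HG => 2 *: e HL - (1 / 12) *: e HC
  | _, _ => 0
  end.

Local Notation e := (@bas F h_index).
Local Notation h_table := (h_gen_table e).

Lemma h_hom k l :
  @homog F (free_space F h_par) (h_par k (+) h_par l) (h_table k l).
Proof.
rewrite /homog /= /free_prj; case: k; case: l; rewrite /= ?lin_zero //.
by rewrite lin_add lin_opp !lin_scale !lin_bas.
Qed.

Lemma h_skew k l : h_table k l = - ((-1) ^+ (h_par k && h_par l) *: h_table l k).
Proof.
by case: k; case: l; rewrite /= ?scaler0 ?oppr0 // expr1 scaleN1r opprK.
Qed.

Lemma h_central k (x : {malg F[h_index]}) : h_par k = false ->
  bilin h_table (e k) x = 0.
Proof.
move=> pk; move: x; apply: bas_ext.
- exact: bilin_linearr.
- by move=> a u v; rewrite scaler0 addr0.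
by move=> l; rewrite bilin_bas; case: k pk.
Qed.

Lemma h_br_br k l (x : {malg F[h_index]}) :
  bilin h_table (h_table k l) x = 0 /\ bilin h_table x (h_table k l) = 0.
Proof.
have Bl := bilin_linearl h_table; have Br := bilin_linearr h_table.
case: k; case: l => /=; rewrite ?(bl0l Bl) ?(bl0r Br) //; split.
  by rewrite (blDl Bl) (blNl Bl) !(blZl Bl) !h_central // !scaler0 subr0.
move: x; apply: bas_ext => [||k].
- exact: Bl.
- by move=> a u v; rewrite scaler0 addr0.
rewrite (blDr Br) (blNr Br) !(blZr Br) !bilin_bas.
by case: k; rewrite /= !scaler0 subr0.
Qed.

Lemma h_jacobi j k l : let B := bilin h_table in
  B (e j) (B (e k) (e l)) = B (B (e j) (e k)) (e l)
    + (-1) ^+ (h_par j && h_par k) *: B (e k) (B (e j) (e l)).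
Proof.
by rewrite /= !bilin_bas !(h_br_br _ _ _).1 !(h_br_br _ _ _).2 scaler0 addr0.
Qed.

(* The (2|1)-dimensional algebra with [G_0, G_0] = 2 L_0 - c / 12. *)
Definition h_qt : lieSuperalgebra F := tableLSA h_hom h_skew h_jacobi.

Lemma h_qt_fin_dim : fin_dim h_qt.
Proof.
apply: (@free_fin_dim F h_index h_par [:: HG; HL; HC]).
  by rewrite /= !inE; do ?case: eqP.
by case; rewrite !inE eqxx ?orbT.
Qed.

Lemma h_qt_quasi_toral : quasi_toral h_qt.
Proof.
move=> x y; move: x; apply: (@free_hom_ext F h_index h_par).
- exact: bilin_linearl.
- by move=> a u v; rewrite scaler0 addr0.
by move=> k pk; apply: h_central.
Qed.

(* The (1|1)-dimensional module with even basis vector [bas F false] and odd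
   basis vector [bas F true], on which G_0 acts by
   even |-> a odd, odd |-> b even, L_0 by the scalar l, and c by 0. *)
Section Module.
Variables a b l : F.

Definition mod_gen_table (V : lmodType F) (m : bool -> V) (k : h_index) (j : bool) :=
  match k, j with
  | HG, false => a *: m true
  | HG, true => b *: m false
  | HL, _ => l *: m j
  | HC, _ => 0
  end.

Local Notation m := (@bas F bool).
Definition mod_table := mod_gen_table m.

Local Notation W := (free_space F (fun j : bool => j)).

Lemma mod_hom p q (x : h_qt) (v : W) : homog p x -> homog q v ->
  @homog F W (p (+) q) (bilin mod_table x v).
Proof.
move=> hx hv; move: x hx; apply: (free_hom_ext (g := (bilin mod_table)^~ v)).
- by move=> c u w; rewrite bilin_linearl; apply: free_prj_linear.
- exact: bilin_linearl.
move=> k pk; move: v hv; apply: (free_hom_ext (g := bilin mod_table (bas F k))).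
- by move=> c u w; rewrite bilin_linearr; apply: free_prj_linear.
- exact: bilin_linearr.
move=> j pj; rewrite bilin_bas -pk -pj /= /free_prj.
by case: k {pk}; case: j {pj}; rewrite /= ?lin_scale ?lin_bas ?lin_zero.
Qed.

Hypothesis abl : a * b = l.

Lemma mod_gen_br (V1 V2 : lmodType F) (e1 : h_index -> V1) (e2 : bool -> V2)
    (B : V1 -> V2 -> V2) :
  (forall y, linear (B^~ y)) -> (forall x, linear (B x)) ->
  (forall k j, B (e1 k) (e2 j) = mod_gen_table e2 k j) ->
  forall k k' j, B (h_gen_table e1 k k') (e2 j) =
    B (e1 k) (B (e1 k') (e2 j))
    - (-1) ^+ (h_par k && h_par k') *: B (e1 k') (B (e1 k) (e2 j)).
Proof.
move=> Bl Br Be k k' j.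
have E := (blDl Bl, blNl Bl, blZl Bl, bl0l Bl, blZr Br, bl0r Br).
case: k; case: k'; case: j; rewrite /= !(E, Be) /= ?(E, Be) /= ?scalerA -?abl;
  rewrite ?scaler0 ?subr0 ?oppr0 -?scalerBl ?(mulr1, mul1r, scale1r) ?subrr //.
all: try (symmetry; apply/eqP; rewrite scaler_eq0 subr_eq0; apply/orP; left;
  apply/eqP; ring).
all: by rewrite ?scale0r //; congr (_ *: _); ring.
Qed.

Lemma mod_br_bas k k' j :
  bilin mod_table (h_table k k') (m j) =
  bilin mod_table (e k) (bilin mod_table (e k') (m j))
  - (-1) ^+ (h_par k && h_par k') *:
      bilin mod_table (e k') (bilin mod_table (e k) (m j)).
Proof.
apply: mod_gen_br => [y|x|k1 j1]; last exact: bilin_bas.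
  exact: bilin_linearl.
exact: bilin_linearr.
Qed.

Lemma mod_br p q (x y : h_qt) (v : W) : homog p x -> homog q y ->
  bilin mod_table (br x y) v = bilin mod_table x (bilin mod_table y v)
    - (-1) ^+ (p && q) *: bilin mod_table y (bilin mod_table x v).
Proof.
have Bl := bilin_linearl mod_table; have Br := bilin_linearr mod_table.
move=> hx hy; move: x hx; apply: free_hom_ext.
- by move=> c u w; rewrite br_linearl bilin_linearl.
- move=> c u w; rewrite !bilin_linearl bilin_linearr.
  by rewrite scalerBr scalerDr opprD addrACA !scalerA [c * _]mulrC.
move=> k pk; move: y hy; apply: free_hom_ext.
- by move=> c u w; rewrite br_linearr bilin_linearl.
- move=> c u w; rewrite !bilin_linearl bilin_linearr.
  by rewrite scalerBr scalerDr opprD addrACA !scalerA [c * _]mulrC.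
move=> k' pk'; move: v; apply: bas_ext.
- exact: bilin_linearr.
- move=> c u w; rewrite !bilin_linearr.
  by rewrite scalerBr scalerDr opprD addrACA !scalerA [c * _]mulrC.
move=> j; rewrite -pk -pk' -mod_br_bas; congr (bilin _ _ _).
exact: bilin_bas.
Qed.

Definition h_mod : superModule h_qt :=
  @SuperModule F h_qt W (bilin mod_table) (fun v => bilin_linearl mod_table v)
    (fun x => bilin_linearr mod_table x) mod_hom mod_br.

Lemma h_mod_fin_dim : fin_dim h_mod.
Proof. by apply: (@free_fin_dim F bool id [:: false; true]) => // -[]. Qed.

Lemma h_mod_weight t (v : h_mod) : homog false t ->
  act t v = (l * (t : {malg F[h_index]})@_HL) *: v.
Proof.
move: t; apply: free_hom_ext.
- exact: bilin_linearl.
- by move=> c u w; rewrite mcoeffD mcoeffZ mulrDr scalerDl scalerA mulrCA.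
move=> k pk; move: v; apply: bas_ext.
- exact: bilin_linearr.
- by move=> c u w; rewrite scalerDr !scalerA mulrC.
move=> j; rewrite [LHS]bilin_bas bas_coef.
case: k pk => //= _; first by rewrite eqxx mulr1.
by case: eqP => //; rewrite mulr0 scale0r.
Qed.

Lemma h_mod_nonzero (U : h_mod -> Prop) : submodule U ->
  (exists u, U u /\ u <> 0) -> exists j (c : F), c != 0 /\ U (c *: m j).
Proof.
move=> [_ _ Up _] [u [Uu u0]].
have uE p : prj p u = (u : {malg F[bool]})@_p *: m p.
  move: u {Uu u0}; apply: bas_ext.
  - exact: free_prj_linear.
  - by move=> c u w; rewrite mcoeffD mcoeffZ scalerDl scalerA.
  move=> k; rewrite [LHS]free_prj_bas bas_coef.
  by case: eqP => [->|]; rewrite ?scale1r ?scale0r.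
have [p up0] : exists p, (u : {malg F[bool]})@_p != 0.
  apply: contra_notP u0 => /forallNP u0.
  by apply/malgP => p; rewrite mcoeff0; apply/eqP/negPn/negP/u0.
by exists p, (u : {malg F[bool]})@_p; split=> //; rewrite -uE; apply: Up.
Qed.

End Module.

(* Cartan data with one simple root, L_0 |-> l and c |-> 0, where g_alpha and
   g_{-alpha} are (1|1)-dimensional and [q i j] is the pairing of the basis
   vector of parity [i] of g_alpha with that of parity [j] of g_{-alpha}. *)
Section Datum.
Variables (l : F) (a b : bool -> F) (q : bool -> bool -> {malg F[h_index]}).
Hypothesis l_neq0 : l != 0.
Hypothesis abl : forall s, a s * b s = (-1) ^+ s * l.
Hypothesis q_hom : forall i j, @homog F h_qt (i (+) j) (q i j).
Hypothesis q_equiv : forall k i j,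
  bilin h_table (e k) (q i j) =
    bilin q (mod_table (a false) (b false) ((-1) ^+ false * l) k i) (bas F j)
    + (-1) ^+ (h_par k && i) *:
        bilin q (bas F i) (mod_table (a true) (b true) ((-1) ^+ true * l) k j).
Hypothesis q_diag : forall i, q i i != 0.

Definition rank1_root (_ : unit) (x : h_qt) : F := l * (x : {malg F[h_index]})@_HL.

Lemma rank1_root_linear i : scalar (rank1_root i).
Proof. by move=> c x y; rewrite /rank1_root mcoeffD mcoeffZ mulrDr mulrCA. Qed.

Lemma rank1_root_odd i x : homog true x -> rank1_root i x = 0.
Proof.
move: x; apply: (@free_hom_ext F h_index h_par F^o (rank1_root i) (fun=> 0)).
- exact: rank1_root_linear.
- by move=> c u v; rewrite scaler0 addr0.
case=> // _; rewrite /rank1_root bas_coef.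
by case: eqP => //; rewrite mulr0.
Qed.

Lemma rank1_root_free (c : unit -> F) :
  (forall t, homog false t -> \sum_i c i * rank1_root i t = 0) ->
  forall i, c i = 0.
Proof.
move=> c0 []; have := c0 (e HL); rewrite (bigD1 tt) //= big1 => [|[]//].
rewrite addr0 /rank1_root bas_coef eqxx mulr1 => /(_ _)/eqP.
rewrite mulf_eq0 (negPf l_neq0) orbF => /(_ _)/eqP-> //.
by rewrite /homog /= free_prj_bas.
Qed.

Definition rank1_mod (_ : unit) (s : bool) : superModule h_qt := h_mod (abl s).

Lemma rank1_weight i s t (v : rank1_mod i s) : homog false t ->
  act t v = ((-1) ^+ s * rank1_root i t) *: v.
Proof. by move=> ht; rewrite [LHS]h_mod_weight // mulrA. Qed.

Definition rank1_pair (i : unit) (u : rank1_mod i false) (v : rank1_mod i true) :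
  h_qt := bilin q u v.

Lemma rank1_pair_hom i p r (u : rank1_mod i false) (v : rank1_mod i true) :
  homog p u -> homog r v -> homog (p (+) r) (rank1_pair u v).
Proof.
move=> hu hv; move: u hu.
apply: (@free_hom_ext F bool id h_qt (fun u => prj (p (+) r) (bilin q u v : h_qt))).
- by move=> c u w; rewrite bilin_linearl; apply: free_prj_linear.
- exact: bilin_linearl.
move=> j pj; move: v hv.
apply: (@free_hom_ext F bool id h_qt
  (fun v => prj (p (+) r) (bilin q (bas F j) v : h_qt))).
- by move=> c u w; rewrite bilin_linearr; apply: free_prj_linear.
- exact: bilin_linearr.
by move=> j' pj'; rewrite [rank1_pair _ _]bilin_bas bilin_bas -pj -pj'; apply: q_hom.
Qed.

Lemma rank1_pair_equiv i p r x (u : rank1_mod i false) (v : rank1_mod i true) :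
  homog p x -> homog r u ->
  br x (rank1_pair u v) =
    rank1_pair (act x u) v + (-1) ^+ (p && r) *: rank1_pair u (act x v).
Proof.
move=> hx hu; move: x hx; apply: free_hom_ext.
- exact: bilin_linearl.
- move=> c y w; rewrite !act_linearl /rank1_pair bilin_linearl bilin_linearr.
  by rewrite !scalerDr addrACA !scalerA [c * _]mulrC.
move=> k pk; move: u hu; apply: (@free_hom_ext F bool id).
- by move=> c y w; rewrite /rank1_pair bilin_linearl br_linearr.
- move=> c y w; rewrite !act_linearr /rank1_pair !bilin_linearl.
  by rewrite !scalerDr addrACA !scalerA [c * _]mulrC.
move=> j pj; move: v; apply: bas_ext.
- by move=> c y w; rewrite /rank1_pair bilin_linearr br_linearr.
- move=> c y w; rewrite !act_linearr /rank1_pair !bilin_linearr.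
  by rewrite !scalerDr addrACA !scalerA [c * _]mulrC.
move=> j'; rewrite -pk -pj.
apply: etrans (congr1 (bilin h_table (e k)) (bilin_bas q j j')) _.
apply: etrans (q_equiv k j j') _.
exact: (congr2 (fun x y => bilin q x (bas F j')
                           + (-1) ^+ (h_par k && j) *: bilin q (bas F j) y)
  (esym (bilin_bas (mod_table (a false) (b false) ((-1) ^+ false * l)) k j))
  (esym (bilin_bas (mod_table (a true) (b true) ((-1) ^+ true * l)) k j'))).
Qed.

Lemma rank1_nondegl i (U : rank1_mod i false -> Prop) :
  submodule U -> (exists u, U u /\ u <> 0) ->
  exists u v, U u /\ rank1_pair u v <> 0.
Proof.
move=> sU /(h_mod_nonzero sU) [j [c [c0 Uc]]].
exists (c *: bas F j), (bas F j); split=> //; apply/eqP.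
rewrite /rank1_pair (blZl (bilin_linearl q)) bilin_bas.
by rewrite scaler_eq0 negb_or c0 q_diag.
Qed.

Lemma rank1_nondegr i (U : rank1_mod i true -> Prop) :
  submodule U -> (exists v, U v /\ v <> 0) ->
  exists u v, U v /\ rank1_pair u v <> 0.
Proof.
move=> sU /(h_mod_nonzero sU) [j [c [c0 Uc]]].
exists (bas F j), (c *: bas F j); split=> //; apply/eqP.
rewrite /rank1_pair (blZr (bilin_linearr q)) bilin_bas.
by rewrite scaler_eq0 negb_or c0 q_diag.
Qed.

Definition rank1_datum : cartanDatum F :=
  @CartanDatum F h_qt h_qt_fin_dim h_qt_quasi_toral unit rank1_root
    rank1_root_linear rank1_root_odd rank1_root_free rank1_mod
    (fun i s => h_mod_fin_dim (abl s)) rank1_weight rank1_pair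
    (fun i v => bilin_linearl q v) (fun i u => bilin_linearr q u)
    rank1_pair_hom rank1_pair_equiv rank1_nondegl rank1_nondegr.

End Datum.
End QuasiToral.

Section Data.
Variable F : numClosedFieldType.
Local Notation h := (h_qt F).
Local Notation e := (@bas F h_index).

(* A_R: the basis of g_{alpha} is L_1 (even), G_1 (odd), that of g_{-alpha} is
   L_{-1}, G_{-1}; [AR_a], [AR_b] are the coefficients of
   [G_0, L_{+-1}] = -+ 1/2 G_{+-1} and [G_0, G_{+-1}] = 2 L_{+-1}. *)
Definition AR_a (s : bool) : F := - ((-1) ^+ s / 2).
Definition AR_b (s : bool) : F := 2.

Lemma AR_ab s : AR_a s * AR_b s = (-1) ^+ s * -1.
Proof. by rewrite /AR_a /AR_b mulNr divfK ?pnatr_eq0 // mulrN1. Qed.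

Definition AR_gen_pair (V : lmodType F) (e : h_index -> V) (i j : bool) : V :=
  match i, j with
  | false, false => 2 *: e HL
  | true, true => 2 *: e HL + (1 / 4) *: e HC
  | false, true => (3 / 2) *: e HG
  | true, false => (3 / 2) *: e HG
  end.

(* A_{N=2}: the basis of g_{alpha/2} is J_{1/2} (even), H_{1/2} (odd), that of
   g_{-alpha/2} is J_{-1/2}, H_{-1/2}; [AN2_a], [AN2_b] are the coefficients of
   [G_0, J_{+-1/2}] = H_{+-1/2} and [G_0, H_{+-1/2}] = -+ 1/2 J_{+-1/2}. *)
Definition AN2_a (s : bool) : F := 1.
Definition AN2_b (s : bool) : F := - ((-1) ^+ s / 2).

Lemma AN2_ab s : AN2_a s * AN2_b s = (-1) ^+ s * (- (1 / 2)).
Proof. by rewrite /AN2_a /AN2_b mul1r mulrN mulrA mulr1. Qed.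

(* With [J_{1/2}, J_{-1/2}] = c/6 and [J_{1/2}, H_{-1/2}] = k G_0, equivariance
   forces [H_{1/2}, H_{-1/2}] = 2k L_0 - (k + 1) c/12 ([AN2_pair_forced]); in
   particular k = -2 is incompatible with [H_{1/2}, H_{-1/2}] = 2 L_0.  The
   values below are k = -1, those of the twisted N = 2 algebra for
   G_0 = G^1_0 and H_r = [G^1_0, J_r] = -i G^2_r. *)
Definition AN2_gen_pair (V : lmodType F) (e : h_index -> V) (i j : bool) : V :=
  match i, j with
  | false, false => (1 / 6) *: e HC
  | false, true => - e HG
  | true, false => e HG
  | true, true => - (2 *: e HL)
  end.

Section Check.
Variables (V W W' : lmodType F) (eh : h_index -> V) (w : bool -> W) (w' : bool -> W').
Variables (B : V -> V -> V) (Q : W -> W' -> V) (phi : V -> F).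
Hypothesis Bl : forall y, linear (B^~ y).
Hypothesis Br : forall x, linear (B x).
Hypothesis Ql : forall y, linear (Q^~ y).
Hypothesis Qr : forall x, linear (Q x).
Hypothesis phil : scalar phi.
Hypothesis Be : forall x y, B (eh x) (eh y) = h_gen_table eh x y.

Let E := (blDr Br, blZr Br, blNr Br, bl0r Br, blZl Ql, bl0l Ql, blZr Qr, bl0r Qr).
Let phiE := (blDp phil, blZp phil, blNp phil, bl0p phil).

Lemma AR_equiv_phi : (forall i j, Q (w i) (w' j) = AR_gen_pair eh i j) ->
  forall k i j, phi (B (eh k) (AR_gen_pair eh i j)) =
  phi (Q (mod_gen_table (AR_a false) (AR_b false) ((-1) ^+ false * -1) w k i) (w' j)
    + (-1) ^+ (h_par k && i) *:
       Q (w i) (mod_gen_table (AR_a true) (AR_b true) ((-1) ^+ true * -1) w' k j)).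
Proof.
move=> Qe k i j; rewrite /AR_a /AR_b.
by case: k; case: i; case: j; rewrite /= ?(E, Be, Qe) /= ?phiE /=;
   move: (phi (eh HL)) (phi (eh HC)) (phi (eh HG)) => ? ? ?; field.
Qed.

Lemma AN2_equiv_phi : (forall i j, Q (w i) (w' j) = AN2_gen_pair eh i j) ->
  forall k i j, phi (B (eh k) (AN2_gen_pair eh i j)) =
  phi (Q (mod_gen_table (AN2_a false) (AN2_b false) ((-1) ^+ false * (- (1 / 2)))
            w k i) (w' j)
    + (-1) ^+ (h_par k && i) *:
       Q (w i) (mod_gen_table (AN2_a true) (AN2_b true) ((-1) ^+ true * (- (1 / 2)))
                  w' k j)).
Proof.
move=> Qe k i j; rewrite /AN2_a /AN2_b.
by case: k; case: i; case: j; rewrite /= ?(E, Be, Qe) /= ?phiE /=;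
   move: (phi (eh HL)) (phi (eh HC)) (phi (eh HG)) => ? ? ?; field.
Qed.
End Check.

Definition AR_pair := AR_gen_pair e.
Definition AN2_pair := AN2_gen_pair e.

Let mcoeff_scalar z : scalar (@mcoeff h_index F z).
Proof. by move=> a x y; rewrite mcoeffD mcoeffZ. Qed.

Lemma AR_equiv k i j : bilin (h_gen_table e) (e k) (AR_pair i j) =
    bilin AR_pair (mod_table (AR_a false) (AR_b false) ((-1) ^+ false * -1) k i)
      (bas F j)
    + (-1) ^+ (h_par k && i) *: bilin AR_pair (bas F i)
        (mod_table (AR_a true) (AR_b true) ((-1) ^+ true * -1) k j).
Proof.
apply/malgP => z; apply: AR_equiv_phi (mcoeff_scalar z) _ _ _ _ _.
- exact: bilin_linearr.
- exact: bilin_linearl.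
- exact: bilin_linearr.
- by move=> x y; apply: bilin_bas.
by move=> x y; apply: bilin_bas.
Qed.

Lemma AN2_equiv k i j : bilin (h_gen_table e) (e k) (AN2_pair i j) =
    bilin AN2_pair
      (mod_table (AN2_a false) (AN2_b false) ((-1) ^+ false * (- (1 / 2))) k i)
      (bas F j)
    + (-1) ^+ (h_par k && i) *: bilin AN2_pair (bas F i)
        (mod_table (AN2_a true) (AN2_b true) ((-1) ^+ true * (- (1 / 2))) k j).
Proof.
apply/malgP => z; apply: AN2_equiv_phi (mcoeff_scalar z) _ _ _ _ _.
- exact: bilin_linearr.
- exact: bilin_linearl.
- exact: bilin_linearr.
- by move=> x y; apply: bilin_bas.
by move=> x y; apply: bilin_bas.
Qed.

Lemma AR_hom i j : @homog F h (i (+) j) (AR_pair i j).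
Proof.
rewrite /homog /= /free_prj; case: i; case: j;
by rewrite /= ?lin_add ?lin_scale ?lin_bas.
Qed.

Lemma AN2_hom i j : @homog F h (i (+) j) (AN2_pair i j).
Proof.
rewrite /homog /= /free_prj; case: i; case: j;
by rewrite /= ?lin_opp ?lin_scale ?lin_bas.
Qed.

Lemma AR_diag i : AR_pair i i != 0.
Proof.
case: i => /=; last by rewrite bas_neq0 ?pnatr_eq0.
apply/eqP => /(congr1 (mcoeff HL)); rewrite coef_add !coef_scale !bas_coef coef_zero.
rewrite eqxx; case: eqP => // _; rewrite mulr0 addr0 mulr1 => /eqP.
by rewrite pnatr_eq0.
Qed.

Lemma AN2_diag i : AN2_pair i i != 0.
Proof.
case: i => /=; rewrite ?oppr_eq0 bas_neq0 ?pnatr_eq0 //.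
by rewrite mulf_neq0 ?oner_eq0 // invr_eq0 pnatr_eq0.
Qed.

Lemma AR_neq0 : -1 != 0 :> F. Proof. by rewrite oppr_eq0 oner_eq0. Qed.
Lemma AN2_neq0 : - (1 / 2) != 0 :> F.
Proof. by rewrite oppr_eq0 mulf_neq0 ?oner_eq0 // invr_eq0 pnatr_eq0. Qed.

Definition A_R : cartanDatum F :=
  rank1_datum AR_neq0 AR_ab AR_hom AR_equiv AR_diag.

Definition A_N2 : cartanDatum F :=
  rank1_datum AN2_neq0 AN2_ab AN2_hom AN2_equiv AN2_diag.

Lemma AN2_pair_forced (k : F)
    (Q : h_mod (AN2_ab false) -> h_mod (AN2_ab true) -> h) :
  (forall v, linear (Q^~ v)) -> (forall u, linear (Q u)) ->
  (forall p q x u v, homog p x -> homog q u ->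
    br x (Q u v) = Q (act x u) v + (-1) ^+ (p && q) *: Q u (act x v)) ->
  Q (bas F false) (bas F false) = (1 / 6) *: e HC ->
  Q (bas F false) (bas F true) = k *: e HG ->
  Q (bas F true) (bas F true) = (2 * k) *: e HL - ((k + 1) / 12) *: e HC.
Proof.
move=> Ql Qr Qequiv JJ JH.
have hG : homog true (e HG : h) by rewrite /homog /= free_prj_bas.
have hJ : homog false (bas F false : h_mod (AN2_ab false)).
  by rewrite /homog /= free_prj_bas.
have := Qequiv true false _ _ (bas F true) hG hJ.
have -> : act (e HG : h) (bas F false : h_mod (AN2_ab false)) = 1 *: bas F true.
  exact: bilin_bas.
have -> : act (e HG : h) (bas F true : h_mod (AN2_ab true))
    = (- ((-1) ^+ true / 2)) *: bas F false.
  exact: bilin_bas.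
rewrite JH (blZr Qr) JJ scale1r expr0 scale1r.
have -> : br (e HG : h) (k *: e HG) = k *: (2 *: e HL - (1 / 12) *: e HC).
  by rewrite brZr; congr (_ *: _); apply: bilin_bas.
move=> /eqP; rewrite -subr_eq => /eqP <-; apply/malgP => z.
rewrite !(coef_add, coef_opp, coef_scale).
by move: ((e HL)@_z) ((e HC)@_z) => ? ?; field.
Qed.

End Data.

(* Main.v *)
From mathcomp Require Import all_boot all_order all_algebra.
From mathcomp Require Import finmap complex boolp reals monalg ring zify.
Require Import Defs.

Set Implicit Arguments.
Unset Strict Implicit.
Unset Printing Implicit Defensive.

Import Order.TTheory GRing.Theory Num.Theory.
Local Open Scope ring_scope.

(* Let M be the Ramond or the twisted N = 2 algebra.  The generators of the
   Cartan datum satisfy its relations in M, which gives a morphism from the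
   universal algebra to M.  It is onto: ad L_{+-1} moves G_n to a nonzero
   multiple of G_{n+-1} (resp. ad J_{+-1/2} moves G^1_m to G^2_{m+-1/2} and
   G^2_r to G^1_{r+-1/2}), and the brackets of the odd elements give the even
   ones.  It is injective on h, so its kernel lies in the maximal ideal.
   Conversely, the image of the maximal ideal is an ideal J of M that meets h
   trivially.  If J were nonzero, it would contain a nonzero vector homogeneous
   for both the parity and the weight of ad L_0; in nonzero weight such a vector
   is a multiple of a basis vector, whose bracket with a vector of opposite
   weight is a nonzero element of h.  Hence J = 0. *)

(** * Morphisms out of the universal algebra, and a criterion for the contragredient algebra to be
    isomorphic to [M] *)

Section UniversalProperty.
Variables (F : numClosedFieldType) (A : cartanDatum F) (M : lieSuperalgebra F).
Variable fh : cd_h A -> M.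
Variable fm : forall (i : cd_I A) (s : bool), cd_mod i s -> M.
Hypothesis fh_linear : linear fh.
Hypothesis fm_linear : forall i s, linear (@fm i s).
Hypothesis fh_prj : forall p x, fh (prj p x) = prj p (fh x).
Hypothesis fm_prj : forall i s p (v : cd_mod i s), fm (prj p v) = prj p (fm v).
Hypothesis fh_br : forall x y, fh (br x y) = br (fh x) (fh y).
Hypothesis fm_act : forall x i s (v : cd_mod i s), fm (act x v) = br (fh x) (fm v).
Hypothesis fm_pair : forall i (u : cd_mod i false) (v : cd_mod i true),
  fh (cd_pair u v) = br (fm u) (fm v).
Hypothesis fm_pair0 : forall i j (u : cd_mod i false) (v : cd_mod j true),
  i <> j -> br (fm u) (fm v) = 0.

Fixpoint pterm_eval (t : pterm A) : M :=
  match t with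
  | PH x => fh x
  | PM i s v => fm v
  | Padd t u => pterm_eval t + pterm_eval u
  | Pscale a t => a *: pterm_eval t
  | Pprj p t => prj p (pterm_eval t)
  | Pbr t u => br (pterm_eval t) (pterm_eval u)
  end.

Let fh0 : fh 0 = 0.
Proof.
have := fh_linear 1 0 0; rewrite !scale1r addr0 => /eqP.
by rewrite -subr_eq subrr => /eqP.
Qed.

(** Every clause of [prel] is a congruence, a law of Lie superalgebras valid in [M], or a defining
    relation, and the latter are the hypotheses on [fh] and [fm]. The zero term is [PH 0], so [fh0]
    enters wherever a clause mentions zero. *)
Lemma pterm_eval_rel t u : prel t u -> pterm_eval t = pterm_eval u.
Proof.
elim=> {t u} //=; do ?by [congruence | move=> *; rewrite ?fh0 ?add0r].
- by move=> *; rewrite addrA.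
- by move=> *; rewrite addrC.
- by move=> *; rewrite scaleN1r addNr fh0.
- by move=> *; rewrite scalerA.
- by move=> *; rewrite scale1r.
- by move=> *; rewrite scalerDr.
- by move=> *; rewrite scalerDl.
- by move=> *; rewrite prj_linear.
- by move=> p q t; rewrite prj_prj; case: eqP => //=; rewrite fh0.
- by move=> *; rewrite prj_sum.
- by move=> *; rewrite br_linearl.
- by move=> *; rewrite br_linearr.
(* The induction hypotheses [ht] and [hu] for the premises [prel (Pprj p t) t] say that the
   evaluated terms are homogeneous, as the graded axioms of [M] require. *)
- by move=> p q t u _ ht _ hu; apply: br_hom.
- by move=> p q t u _ ht _ hu; rewrite scaleN1r; apply: br_skew.
- by move=> p q t u v _ ht _ hu; apply: br_jacobi.
- by move=> *; rewrite fm_pair0 // fh0.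
Qed.

Definition gtilde_lift (x : gtilde A) : M := pterm_eval (@qrepr F (gtilde_pre A) x).

Lemma gtilde_lift_pi t : gtilde_lift (@qpi F (gtilde_pre A) t) = pterm_eval t.
Proof. exact/pterm_eval_rel/(@qreprP F (gtilde_pre A)). Qed.

Lemma gtilde_lift_linear : linear gtilde_lift.
Proof.
move=> a; elim/(@qpiW F (gtilde_pre A))=> x; elim/(@qpiW F (gtilde_pre A))=> y.
by rewrite -(@qpiZ F (gtilde_pre A)) -(@qpiD F (gtilde_pre A)) !gtilde_lift_pi.
Qed.

Lemma gtilde_lift_prj p x : gtilde_lift (prj p x) = prj p (gtilde_lift x).
Proof.
elim/(@qpiW F (gtilde_pre A)): x => x.
by rewrite -[prj p _]/(@qprj F (gtilde_pre A) p (qpi _)) qprjE !gtilde_lift_pi.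
Qed.

Lemma gtilde_lift_br x y :
  gtilde_lift (br x y) = br (gtilde_lift x) (gtilde_lift y).
Proof.
elim/(@qpiW F (gtilde_pre A)): x => x; elim/(@qpiW F (gtilde_pre A)): y => y.
by rewrite -[br _ _]/(@qbr F (gtilde_pre A) (qpi _) (qpi _)) qbrE !gtilde_lift_pi.
Qed.

Lemma gtilde_lift_h x : gtilde_lift (gt_h x) = fh x.
Proof. exact: gtilde_lift_pi. Qed.

Lemma gtilde_lift_m i s (v : cd_mod i s) : gtilde_lift (gt_m v) = fm v.
Proof. exact: gtilde_lift_pi. Qed.

Let ps := gtilde_lift.
Let ps0 : ps 0 = 0. Proof. exact: etrans (gtilde_lift_h 0) fh0. Qed.
Let psB x y : ps (x - y) = ps x - ps y.
Proof. by rewrite -scaleN1r addrC [LHS]gtilde_lift_linear scaleN1r addrC. Qed.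

Hypothesis fh_inj : forall x, fh x = 0 -> x = 0.
(** Generation is phrased as an induction principle; surjectivity results from taking [S] to be the
    image of [gtilde_lift]. *)
Hypothesis M_gen : forall S : M -> Prop,
  (forall a x y, S x -> S y -> S (a *: x + y)) ->
  (forall x y, S x -> S y -> S (br x y)) ->
  (forall x, S (fh x)) -> (forall i s (v : cd_mod i s), S (fm v)) ->
  forall x, S x.
(** This is weaker than simplicity, which fails in the intended algebras because the central element
    spans an ideal. *)
Hypothesis M_simple : forall J : ideal M,
  (forall x, J (fh x) -> x = 0) -> forall x, J x -> x = 0.

Lemma gtilde_lift_surj y : exists x, gtilde_lift x = y.
Proof.
move: y; apply: M_gen.
- by move=> a _ _ [x <-] [y <-]; exists (a *: x + y); apply: gtilde_lift_linear.
- by move=> _ _ [x <-] [y <-]; exists (br x y); apply: gtilde_lift_br.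
- by move=> x; exists (gt_h x); apply: gtilde_lift_h.
- by move=> i s v; exists (gt_m v); apply: gtilde_lift_m.
Qed.

Definition gtilde_lift_ker : ideal (gtilde A).
Proof.
refine (@Ideal F (gtilde A) (fun x => ps x = 0) ps0 _ _ _).
- by move=> a x y x0 y0; rewrite [LHS]gtilde_lift_linear -!/(ps _) x0 y0 scaler0 addr0.
- by move=> p x x0; rewrite [LHS]gtilde_lift_prj -!/(ps _) x0 prj0.
- by move=> x y y0; rewrite [LHS]gtilde_lift_br -!/(ps _) y0 br0r.
Defined.

(** Injectivity of [fh] makes the kernel an ideal that meets [h] trivially, and the maximal ideal
    contains all of these. *)
Lemma gtilde_lift_ker_max x : ps x = 0 -> max_ideal A x.
Proof.
move=> x0; apply: (max_idealP A).2 (_ : gtilde_lift_ker x) => // y.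
by rewrite /= /ps gtilde_lift_h => /fh_inj ->; apply: gt_h0.
Qed.

(** Stability under brackets with all of [M] relies on the surjectivity of [gtilde_lift]. *)
Definition max_ideal_image : ideal M.
Proof.
refine (@Ideal F M (fun y => exists2 x, max_ideal A x & ps x = y) _ _ _ _).
- by exists 0 => //; apply: id_0.
- move=> a _ _ [x mx <-] [y my <-]; exists (a *: x + y); first exact: id_lin.
  exact: gtilde_lift_linear.
- by move=> p _ [x mx <-]; exists (prj p x); [apply: id_prj|apply: gtilde_lift_prj].
- move=> z _ [y my <-]; have [x <-] := gtilde_lift_surj z.
  by exists (br x y); [apply: id_br|apply: gtilde_lift_br].
Defined.

(* The maximal ideal maps to an ideal of [M] that still meets [h] trivially,
   because the kernel is contained in it; hence it is the kernel. *)
Lemma max_ideal_ker x : max_ideal A x -> ps x = 0.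
Proof.
move=> mx; apply: (M_simple (J := max_ideal_image)); last by exists x.
move=> y [z mz zE]; apply: fh_inj; rewrite -gtilde_lift_h.
suff -> : gt_h y = 0 by exact: ps0.
apply: (max_idealP A).1.
have -> : gt_h y = z - (z - gt_h y) by rewrite opprB addrC subrK.
apply: idB => //; apply: gtilde_lift_ker_max.
by rewrite psB zE /ps gtilde_lift_h subrr.
Qed.

(** The kernel of the surjection [gtilde_lift] is exactly the maximal ideal, by
    [gtilde_lift_ker_max] and [max_ideal_ker], so it descends to a bijection on the quotient. *)
Lemma galg_iso : lsa_iso (galg A) M.
Proof.
pose Q := pre_by_ideal (max_ideal A).
pose f (x : galg A) : M := ps (@qrepr F Q x).
(* Two representatives of a class differ by an element of the maximal ideal, which [ps] kills. *)
have fpi x : f (@qpi F Q x) = ps x.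
  have /max_ideal_ker := @qreprP F Q x.
  by rewrite psB => /eqP; rewrite subr_eq0 => /eqP.
have fl : linear f.
  move=> a; elim/(@qpiW F Q)=> x; elim/(@qpiW F Q)=> y.
  rewrite -(@qpiZ F Q) -(@qpiD F Q) !fpi; exact: gtilde_lift_linear.
have fB x y : f (x - y) = f x - f y.
  by rewrite -scaleN1r addrC fl scaleN1r addrC.
have f_inj x y : f x = f y -> x = y.
  move=> /eqP; rewrite -subr_eq0 -fB => /eqP f0; apply/eqP; rewrite -subr_eq0.
  apply/eqP; move: f0; elim/(@qpiW F Q): (x - y) => z; rewrite fpi.
  move=> /gtilde_lift_ker_max mz; rewrite -(@qpi0 F Q); apply/qpiP.
  by rewrite /= subr0.
have f_surj y : exists x, f x = y.
  by have [x <-] := gtilde_lift_surj y; exists (@qpi F Q x); apply: fpi.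
have [g gK] := choice f_surj.
exists f; split=> //.
- by exists g => // x; apply: f_inj.
- move=> p; elim/(@qpiW F Q)=> x.
  rewrite -[prj p _]/(@qprj F Q p (qpi _)) qprjE !fpi; exact: gtilde_lift_prj.
- elim/(@qpiW F Q)=> x; elim/(@qpiW F Q)=> y.
  rewrite -[br _ _]/(@qbr F Q (qpi _) (qpi _)) qbrE !fpi; exact: gtilde_lift_br.
Qed.

End UniversalProperty.

(** * Ideals of an algebra with a basis of eigenvectors for one adjoint operator *)

Section WeightIdeals.
Variables (F : numClosedFieldType) (K : choiceType) (par : K -> bool).
Variable t : K -> K -> {malg F[K]}.
Hypothesis t_hom : forall k l, @homog F (free_space F par) (par k (+) par l) (t k l).
Hypothesis t_skew : forall k l, t k l = - ((-1) ^+ (par k && par l) *: t l k).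
Hypothesis t_jacobi : forall k l m,
  bilin t (bas F k) (bilin t (bas F l) (bas F m)) =
    bilin t (bilin t (bas F k) (bas F l)) (bas F m)
    + (-1) ^+ (par k && par l) *:
        bilin t (bas F l) (bilin t (bas F k) (bas F m)).
Local Notation M := (tableLSA t_hom t_skew t_jacobi).
Variables (d : K) (wt : K -> F).
Hypothesis wtE : forall k, t d k = wt k *: bas F k.
(** Parity is needed to separate pairs such as L_n and G_n of equal weight. Weight zero is excluded
    because L_0 and c are both even there. *)
Hypothesis wt_inj : forall k l, wt k = wt l -> par k = par l -> wt k != 0 -> k = l.

(** The zero eigenspace of the adjoint action of [bas F d]; in both applications it is the image of
    [h]. *)
Definition weight0 (x : {malg F[K]}) := forall k, wt k != 0 -> x@_k = 0.

Hypothesis wt_dual : forall k, wt k != 0 ->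
  exists l, weight0 (t l k) /\ t l k != 0.

Lemma br_weight_coef (x : M) k :
  (br (bas F d : M) x : {malg F[K]})@_k = wt k * (x : {malg F[K]})@_k.
Proof.
pose f (x : {malg F[K]}) : F^o := (bilin t (bas F d) x)@_k.
pose g (x : {malg F[K]}) : F^o := wt k * x@_k.
suff: f =1 g by apply.
apply: bas_ext.
- by move=> a u v; rewrite /f bilin_linearr mcoeffD mcoeffZ.
- by move=> a u v; rewrite /g mcoeffD mcoeffZ mulrDr mulrCA.
move=> l; rewrite /f /g bilin_bas wtE mcoeffZ bas_coef.
by case: eqP => [->|] //; rewrite !mulr0.
Qed.

Lemma prj_coef p (x : M) k :
  (prj p x : {malg F[K]})@_k = if par k == p then (x : {malg F[K]})@_k else 0.
Proof.
pose f (x : {malg F[K]}) : F^o := (free_prj par p x)@_k.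
pose g (x : {malg F[K]}) : F^o := if par k == p then x@_k else 0.
suff: f =1 g by apply.
apply: bas_ext.
- by move=> a u v; rewrite /f free_prj_linear mcoeffD mcoeffZ.
- move=> a u v; rewrite /g; case: eqP => _; first by rewrite mcoeffD mcoeffZ.
  by rewrite scaler0 addr0.
move=> l; rewrite /f /g free_prj_bas (fun_if (mcoeff k)) coef_zero bas_coef.
by case: (eqVneq l k) => [-> //|_]; rewrite !if_same.
Qed.

Lemma malg_neq0 (x : {malg F[K]}) : x != 0 -> exists k, x@_k != 0.
Proof.
move=> /eqP x0; apply: contra_notP x0 => /forallNP x0.
by apply/malgP => k; rewrite mcoeff0; apply/eqP/negPn/negP/x0.
Qed.

(* Killing one weight of [x] with [ad d - wt k] shrinks its support. *)
Lemma ideal_weight_vector (J : ideal M) (x : M) : J x -> x != 0 ->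
  exists2 y : M, J y & exists2 k, (y : {malg F[K]})@_k != 0 &
    forall l, (y : {malg F[K]})@_l != 0 -> wt l = wt k /\ par l = par k.
Proof.
move=> Jx /malg_neq0 [k0 xk0].
have {Jx xk0 x} [x [Jx xk0 xp]] : exists x : M, [/\ J x, (x : {malg F[K]})@_k0 != 0
    & forall l, (x : {malg F[K]})@_l != 0 -> par l = par k0].
  exists (prj (par k0) x); split; first exact: id_prj.
    by rewrite prj_coef eqxx.
  by move=> l; rewrite prj_coef; case: (par l =P par k0) => // _ /eqP.
have [n xn] := ubnP (size (msupp (x : {malg F[K]}))).
elim: n k0 x Jx xk0 xp xn => // n IH k0 x Jx xk0 xp xn.
have [[l [xl lk]]|nE] := pselect (exists l, (x : {malg F[K]})@_l != 0 /\ wt l <> wt k0);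
  last first.
  exists x => //; exists k0 => // l xl; split; last exact: xp.
  by apply: contrapT => lk; apply: nE; exists l.
pose y : M := br (bas F d : M) x - wt k0 *: x.
have yE z : (y : {malg F[K]})@_z = (wt z - wt k0) * (x : {malg F[K]})@_z.
  by rewrite /y coef_add coef_opp coef_scale br_weight_coef mulrBl.
apply: (IH l y).
- by apply: idB; [apply: id_br|apply: idZ].
- by rewrite yE mulf_neq0 // subr_eq0; apply/eqP.
- move=> z; rewrite yE mulf_eq0 negb_or => /andP[_ /xp ->].
  by rewrite xp.
apply: leq_trans (_ : size (msupp (x : {malg F[K]})) <= n)%N; last exact: xn.
apply: fproper_ltn_card; rewrite fproperE; apply/andP; split.
  apply/fsubsetP => z; rewrite -!mcoeff_neq0 yE mulf_eq0 negb_or.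
  by move=> /andP[].
apply/negP => /fsubsetP/(_ k0).
by rewrite -!mcoeff_neq0 xk0 yE subrr mul0r eqxx => /(_ isT).
Qed.

Lemma weight0_ideal_eq0 (J : ideal M) :
  (forall x : M, weight0 x -> J x -> x = 0) -> forall x, J x -> x = 0.
Proof.
move=> J0 x Jx; apply/eqP/negPn/negP => x0.
have [y Jy [k yk yP]] := ideal_weight_vector Jx x0.
have [k0|k0] := eqVneq (wt k) 0.
  suff y0 : y = 0 by move: yk; rewrite y0 coef_zero eqxx.
  apply: J0 => // l wl; apply/eqP; apply: contraNT wl => /yP[-> _].
  exact/eqP.
have [l [w0 lk0]] := wt_dual k0.
(* The whole support of [y] has the weight and parity of [k], and [wt_inj] leaves only [k]
   itself. *)
have yE : y = (y : {malg F[K]})@_k *: bas F k :> M.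
  apply/malgP => z; rewrite coef_scale bas_coef.
  case: (eqVneq k z) => [->|/eqP kz]; first by rewrite mulr1.
  rewrite mulr0; apply/eqP; apply: contra_notT kz => /yP[wz pz].
  by symmetry; apply: wt_inj => //; rewrite wz.
have brE : br (bas F l : M) y = (y : {malg F[K]})@_k *: t l k.
  by rewrite {1}yE brZr; congr (_ *: _); apply: bilin_bas.
(* This bracket lies in [J] and has weight zero, so it must vanish, whereas [wt_dual] makes it
   nonzero. *)
have : br (bas F l : M) y = 0.
  apply: J0; last exact: id_br.
  by rewrite brE => z wz; rewrite coef_scale w0 ?mulr0.
rewrite brE => /eqP; rewrite scaler_eq0; apply/negP.
by rewrite negb_or yk.
Qed.

End WeightIdeals.

(** * Compatibility of linear extensions with gradings and brackets, reduced to basis vectors *)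

Section LinearExtension.
Variables (F : numClosedFieldType) (M : lieSuperalgebra F).

Lemma lin_prj (K : choiceType) (par : K -> bool) (e : K -> M) p
    (x : free_space F par) : (forall k, homog (par k) (e k)) ->
  lin e (prj p x) = prj p (lin e x).
Proof.
move=> e_hom; move: x; apply: bas_ext.
- by move=> c u v; rewrite prj_linear lin_linear.
- by move=> c u v; rewrite lin_linear prj_linear.
move=> k; rewrite [prj p _]free_prj_bas (fun_if (lin e)) lin_zero lin_bas.
by rewrite -(e_hom k) prj_prj eq_sym; case: eqP => // <-.
Qed.

(** Three separate index types let one statement serve the bracket of [h], its action on the root
    modules, and the pairing. *)
Lemma lin_bilin (K K' K'' : choiceType) (e : K -> M) (e' : K' -> M) (e'' : K'' -> M)
    (tb : K -> K' -> {malg F[K'']}) x y :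
  (forall k k', br (e k) (e' k') = lin e'' (tb k k')) ->
  lin e'' (bilin tb x y) = br (lin e x) (lin e' y).
Proof.
move=> tbE; move: x; apply: bas_ext.
- by move=> c u v; rewrite bilin_linearl lin_linear.
- by move=> c u v; rewrite lin_linear br_linearl.
move=> k; move: y; apply: bas_ext.
- by move=> c u v; rewrite bilin_linearr lin_linear.
- by move=> c u v; rewrite lin_linear br_linearr.
by move=> k'; rewrite bilin_bas !lin_bas tbE.
Qed.

End LinearExtension.

(** * The isomorphism criterion for one simple root, as finitely many identities between basis
    vectors plus generation and the ideal condition *)

Section Rank1.
Variables (F : numClosedFieldType) (M : lieSuperalgebra F).
Variables (eh : h_index -> M) (em : bool -> bool -> M).
Variables (l : F) (a b : bool -> F) (q : bool -> bool -> {malg F[h_index]}).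
Hypothesis l_neq0 : l != 0.
Hypothesis abl : forall s, a s * b s = (-1) ^+ s * l.
Hypothesis q_hom : forall i j, @homog F (h_qt F) (i (+) j) (q i j).
Hypothesis q_equiv : forall k i j,
  bilin (h_gen_table (@bas F h_index)) (bas F k) (q i j) =
    bilin q (mod_table (a false) (b false) ((-1) ^+ false * l) k i) (bas F j)
    + (-1) ^+ (h_par k && i) *:
        bilin q (bas F i) (mod_table (a true) (b true) ((-1) ^+ true * l) k j).
Hypothesis q_diag : forall i, q i i != 0.
Hypothesis eh_hom : forall k, homog (h_par k) (eh k).
Hypothesis em_hom : forall s j, homog j (em s j).
Hypothesis eh_br : forall k k', br (eh k) (eh k') = h_gen_table eh k k'.
Hypothesis em_act : forall k s j,
  br (eh k) (em s j) = mod_gen_table (a s) (b s) ((-1) ^+ s * l) (em s) k j.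
Hypothesis em_pair : forall i j, br (em false i) (em true j) = lin eh (q i j).
Hypothesis eh_free : forall x, lin eh x = 0 -> x = 0.
Hypothesis M_gen : forall S : M -> Prop,
  (forall a x y, S x -> S y -> S (a *: x + y)) ->
  (forall x y, S x -> S y -> S (br x y)) ->
  (forall k, S (eh k)) -> (forall s j, S (em s j)) -> forall x, S x.
Hypothesis M_simple : forall J : ideal M,
  (forall x, J (lin eh x) -> x = 0) -> forall x, J x -> x = 0.

Lemma rank1_iso :
  lsa_iso (galg (rank1_datum l_neq0 abl q_hom q_equiv q_diag)) M.
Proof.
pose A := rank1_datum l_neq0 abl q_hom q_equiv q_diag.
pose fm (i : cd_I A) s : cd_mod i s -> M := lin (em s).
apply: (@galg_iso F A M (lin eh) fm).
- exact: lin_linear.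
- by move=> i s; apply: lin_linear.
- by move=> p x; apply: lin_prj.
- by move=> i s p x; apply: lin_prj.
- move=> x y; apply: lin_bilin => k k'; rewrite eh_br.
  by case: k; case: k'; rewrite /= ?lin_zero // lin_add lin_opp !lin_scale !lin_bas.
- move=> x i s v; apply: lin_bilin => k j; rewrite em_act.
  by case: k; case: j; rewrite /mod_table /= ?lin_zero // lin_scale lin_bas.
- by move=> i u v; apply: lin_bilin => j k; rewrite em_pair.
(* Simple roots are indexed by [unit], so the relation for distinct roots is vacuous. *)
- by move=> [] [].
- exact: eh_free.
- move=> S Sl Sb Sh Sm; apply: M_gen => // [k|s j].
    by rewrite -(lin_bas eh k); apply: Sh.
  by rewrite -(lin_bas (em s) j); apply: (Sm tt).
- exact: M_simple.
Qed.

End Rank1.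

(** * Subspaces of free modules, the weight-zero space, and half-integers *)

Section FreeSubspaces.
Variables (F : numClosedFieldType) (K : choiceType).

Lemma lin_bas_coef (J : choiceType) (iota : J -> K) (x : {malg F[J]}) j :
  injective iota -> (lin (fun j => bas F (iota j)) x)@_(iota j) = x@_j.
Proof.
move=> iota_inj.
pose f (x : {malg F[J]}) : F^o := (lin (fun j => bas F (iota j)) x)@_(iota j).
pose g (x : {malg F[J]}) : F^o := x@_j.
suff: f =1 g by apply.
apply: bas_ext.
- by move=> a u v; rewrite /f lin_linear mcoeffD mcoeffZ.
- by move=> a u v; rewrite /g mcoeffD mcoeffZ.
by move=> k; rewrite /f /g lin_bas /= !bas_coef (inj_eq iota_inj).
Qed.

Lemma lin_bas_inj (J : choiceType) (iota : J -> K) (x : {malg F[J]}) :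
  injective iota -> lin (fun j => bas F (iota j)) x = 0 -> x = 0.
Proof.
move=> iota_inj x0; apply/malgP => j.
by rewrite -(lin_bas_coef x j iota_inj) x0 !coef_zero.
Qed.

Section WeightZero.
Variable wt : K -> F.

Lemma weight0_bas k : wt k = 0 -> weight0 wt (bas F k).
Proof.
move=> k0 l wl; rewrite bas_coef; case: eqP => // kl.
by rewrite -kl k0 eqxx in wl.
Qed.

Lemma weight0_add x y : weight0 wt x -> weight0 wt y -> weight0 wt (x + y).
Proof. by move=> x0 y0 k wk; rewrite coef_add x0 ?y0 ?addr0. Qed.

Lemma weight0_scale a x : weight0 wt x -> weight0 wt (a *: x).
Proof. by move=> x0 k wk; rewrite coef_scale x0 ?mulr0. Qed.

Lemma weight0_lin (iota : h_index -> K) x : injective iota ->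
  (forall k, wt k = 0 -> exists j, k = iota j) ->
  weight0 wt x -> exists y, x = lin (fun j => bas F (iota j)) y.
Proof.
move=> iota_inj iota_surj x0.
(* The preimage copies the three coefficients of [x] at the basis of [h]; all others have nonzero
   weight and vanish. *)
exists (x@_(iota HG) *: bas F HG + x@_(iota HL) *: bas F HL + x@_(iota HC) *: bas F HC).
apply/malgP => z; rewrite !(lin_add, lin_scale, lin_bas) /=.
rewrite !(coef_add, coef_scale, bas_coef).
have [z0|z0] := eqVneq (wt z) 0; last first.
  rewrite x0 //; symmetry.
  have E j : x@_(iota j) * (iota j == z)%:R = 0.
    by case: eqP => [->|]; rewrite ?mulr0 // x0 ?mul0r.
  by rewrite !E !addr0.
have [j ->] := iota_surj z z0; rewrite !(inj_eq iota_inj).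
by case: j; do !case: eqP => //=; rewrite !(mulr0, mulr1, addr0, add0r).
Qed.

End WeightZero.

Lemma free_closed (S : {malg F[K]} -> Prop) : S 0 ->
  (forall a x y, S x -> S y -> S (a *: x + y)) -> (forall k, S (bas F k)) ->
  forall x, S x.
Proof.
move=> S0 Sl Sb x; rewrite (bas_sum x); elim: (enum_fset _) => [|k r IH].
  by rewrite big_nil.
by rewrite big_cons; apply: Sl.
Qed.

End FreeSubspaces.

Section Subspaces.
Variables (F : numClosedFieldType) (V : lmodType F) (S : V -> Prop).
Hypothesis Sl : forall a x y, S x -> S y -> S (a *: x + y).

Lemma subspace0 x : S x -> S 0.
Proof. by move=> Sx; have := Sl (-1) Sx Sx; rewrite scaleN1r addNr. Qed.

Lemma subspaceZ a x : S x -> S (a *: x).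
Proof. by move=> Sx; have := Sl a Sx (subspace0 Sx); rewrite addr0. Qed.

(** In the generation arguments this divides a bracket by its nonzero structure constant. *)
Lemma subspaceZ_inv a x : a != 0 -> S (a *: x) -> S x.
Proof. by move=> a0 /(subspaceZ a^-1); rewrite scalerA mulVf // scale1r. Qed.

(** In the generation arguments this discards the central term of a bracket. *)
Lemma subspaceD_inv a x y : S y -> S (x + a *: y) -> S x.
Proof.
by move=> Sy /(Sl (- a) Sy); rewrite addrC scaleNr addrK.
Qed.

End Subspaces.

(** Twice the difference is the odd integer 2k + 1 - 2m. This keeps integral and half-integral
    weights apart and half-integral structure constants nonzero. *)
Lemma half_neq_int (F : numClosedFieldType) (k m : int) : half F k != m%:~R.
Proof.
have E : half F k - m%:~R = (2 * k + 1 - 2 * m)%:~R / 2 by rewrite /half; field.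
rewrite -subr_eq0 E mulf_neq0 ?invr_eq0 ?pnatr_eq0 // intr_eq0.
by apply/eqP; lia.
Qed.

Lemma half_neq0 (F : numClosedFieldType) (k : int) : half F k != 0.
Proof. exact: half_neq_int k 0. Qed.

Lemma half_inj (F : numClosedFieldType) : injective (half F).
Proof. by move=> m n /addIr/intr_inj. Qed.

(** Only arguments of the constructor [c] are evaluated, leaving the coefficients in [F] untouched
    for [field]. Equal basis vectors become syntactically equal, so each can be treated as one
    unknown. *)
Ltac eval_index c :=
  repeat match goal with
  | |- context [c ?i] => let v := eval vm_compute in i in
       tryif constr_eq i v then fail else change (c i) with (c v)
  end.

(* The index arithmetic is on closed integers, so it is done by evaluation. *)
Ltac coef_simpl :=
  rewrite ?(lin_add, lin_opp, lin_scale, lin_bas, lin_zero);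
  rewrite ?(coef_add, coef_opp, coef_scale, coef_zero) /=;
  eval_index RL; eval_index RG;
  eval_index NL; eval_index NJ; eval_index NG1; eval_index NG2;
  repeat match goal with |- context [@mcoeff ?K ?R ?z ?x] =>
    let c := fresh "c" in
    pose c := @mcoeff K R z x;
    repeat match goal with |- context [@mcoeff ?K1 ?R1 z x] =>
      change (@mcoeff K1 R1 z x) with c end;
    clearbody c
  end.

(** * The Ramond algebra *)

Section Ramond.
Variable F : numClosedFieldType.
Local Notation M := (ramond F).
Local Notation e := (@bas F ramond_index).

Lemma ramond_br k l : br (e k : M) (e l : M) = ramond_table e k l.
Proof. exact: bilin_bas. Qed.

Definition ramond_wt (k : ramond_index) : F :=
  match k with RL n | RG n => - n%:~R | RC => 0 end.

Lemma ramond_wtE k : ramond_table e (RL 0) k = ramond_wt k *: e k.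
Proof.
case: k => [n|n|] /=; last by rewrite scale0r.
  by rewrite !mul0r scale0r addr0 !add0r mulrNz.
by rewrite add0r mul0r sub0r.
Qed.

Lemma ramond_wt_inj k l : ramond_wt k = ramond_wt l ->
  ramond_par k = ramond_par l -> ramond_wt k != 0 -> k = l.
Proof.
case: k => [m|m|]; case: l => [n|n|] //=; rewrite ?eqxx //.
- by move=> /oppr_inj/intr_inj ->.
- by move=> ->; rewrite eqxx.
- by move=> /oppr_inj/intr_inj ->.
Qed.

(** L_{-n} serves for both parities: its bracket with L_n is -2n L_0 plus a central term, which
    cannot cancel L_0, and its bracket with G_n is -(3n/2) G_0. *)
Lemma ramond_wt_dual k : ramond_wt k != 0 ->
  exists l, weight0 ramond_wt (ramond_table e l k) /\ ramond_table e l k != 0.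
Proof.
case: k => [n|n|] /=; rewrite ?eqxx // oppr_eq0 intr_eq0 => n0; exists (RL (- n)).
  rewrite /= addNr; split.
    apply: weight0_add; apply: weight0_scale; apply: weight0_bas => //=.
    by rewrite oppr0.
  apply/eqP => /(congr1 (mcoeff (RL 0))).
  rewrite coef_add !coef_scale !bas_coef coef_zero eqxx mulr1.
  case: (RC =P RL 0) => // _; rewrite mulr0 addr0 => /eqP; rewrite intr_eq0.
  by move: n0; lia.
rewrite /= addNr; split.
  by apply: weight0_scale; apply: weight0_bas => //=; rewrite oppr0.
apply: bas_neq0.
have -> : (- n)%:~R / 2 - n%:~R = - (3 / 2) * n%:~R :> F by field.
by rewrite !mulf_neq0 ?oppr_eq0 ?intr_eq0 ?mulf_neq0 ?invr_eq0 ?pnatr_eq0.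
Qed.

Definition ramond_of_h (k : h_index) : ramond_index :=
  match k with HG => RG 0 | HL => RL 0 | HC => RC end.

Lemma ramond_of_h_inj : injective ramond_of_h. Proof. by do 2!case. Qed.

Lemma ramond_of_h_wt k : ramond_wt k = 0 -> exists j, k = ramond_of_h j.
Proof.
case: k => [n|n|] /=; last by exists HC.
  by move=> /eqP; rewrite oppr_eq0 intr_eq0 => /eqP ->; exists HL.
by move=> /eqP; rewrite oppr_eq0 intr_eq0 => /eqP ->; exists HG.
Qed.

Definition ramond_of_mod (s j : bool) : ramond_index :=
  (if j then RG else RL) (if s then -1 else 1).

Lemma ramond_gen (S : M -> Prop) :
  (forall a x y, S x -> S y -> S (a *: x + y)) ->
  (forall x y, S x -> S y -> S (br x y)) ->
  (forall k, S (e (ramond_of_h k))) -> (forall s j, S (e (ramond_of_mod s j))) ->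
  forall x, S x.
Proof.
move=> Sl Sb Sh Sm.
have SC : S (e RC) := Sh HC.
have SG n : S (e (RG n)).
  elim: n => [|n IH|n IH]; first exact: (Sh HG).
    have := Sb _ _ (Sm false false) IH; rewrite ramond_br /= -intS.
    (* The structure constant of [L_1, G_n] is a half-integer, hence never zero; the same happens
       below for L_{-1}. *)
    have -> : 1%:~R / 2 - n%:~R = half F (- n%:Z) by rewrite /half; field.
    exact/(subspaceZ_inv Sl)/half_neq0.
  have := Sb _ _ (Sm true false) IH; rewrite ramond_br /=.
  have -> : -1 + - n%:Z = - n.+1%:Z by rewrite -opprD -intS.
  have -> : (-1)%:~R / 2 - (- n%:Z)%:~R = - half F (- n%:Z) by rewrite /half; field.
  by apply: (subspaceZ_inv Sl); rewrite oppr_eq0 half_neq0.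
apply: (@free_closed F ramond_index) => //; first exact: subspace0 SC.
(* [G_n, G_0] is 2 L_n up to a multiple of c, which already lies in [S]. *)
case=> [n||] //; have := Sb _ _ (SG n) (SG 0); rewrite ramond_br /= addr0.
move=> /(subspaceD_inv Sl SC); apply: (subspaceZ_inv Sl).
by rewrite pnatr_eq0.
Qed.

(** The generators satisfy the relations of [A_R] coefficient by coefficient: the central factor
    (m^2 - 1/4)/3 gives -c/12 at m = 0 and c/4 at m = 1. *)
Lemma ramond_iso : lsa_iso (galg (A_R F)) M.
Proof.
apply: (@rank1_iso F M (fun k => e (ramond_of_h k)) (fun s j => e (ramond_of_mod s j))).
- by case; rewrite /homog /= free_prj_bas.
- by case; case; rewrite /homog /= free_prj_bas.
- by move=> k k'; rewrite ramond_br; apply/malgP => z; case: k; case: k'; rewrite /= ; coef_simpl; field.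
- by move=> k s j; rewrite ramond_br; apply/malgP => z; case: k; case: s; case: j;
    rewrite /AR_a /AR_b /=; coef_simpl; field.
- by move=> i j; rewrite ramond_br; apply/malgP => z; case: i; case: j => /=; coef_simpl; field.
- move=> x; apply: lin_bas_inj; exact: ramond_of_h_inj.
- exact: ramond_gen.
(* It remains to treat weight-zero elements of [J]; they come from [h] by [weight0_lin], so [J0]
   kills them. *)
move=> J J0; apply: (weight0_ideal_eq0 ramond_wtE ramond_wt_inj ramond_wt_dual).
move=> x /(weight0_lin ramond_of_h_inj ramond_of_h_wt) [y ->] /J0 ->.
exact: lin_zero.
Qed.

End Ramond.

(** * The twisted N = 2 algebra *)

Section TwistedN2.
Variable F : numClosedFieldType.
Local Notation M := (twistedN2 F).
Local Notation e := (@bas F n2_index).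
Let ii : 'i ^+ 2 = -1 :> F := sqrCi F.
Let i_neq0 : 'i != 0 :> F := neq0Ci F.

Lemma n2_br k l : br (e k : M) (e l : M) = n2_table e k l.
Proof. exact: bilin_bas. Qed.

Definition n2_wt (k : n2_index) : F :=
  match k with
  | NL n | NG1 n => - n%:~R
  | NJ n | NG2 n => - half F n
  | NC => 0
  end.

Lemma n2_wtE k : n2_table e (NL 0) k = n2_wt k *: e k.
Proof.
case: k => [n|n|n|n|] /=; last by rewrite scale0r.
- by rewrite !mul0r scale0r addr0 !add0r mulrNz.
- by rewrite add0r.
- by rewrite add0r mul0r sub0r.
- by rewrite add0r mul0r sub0r.
Qed.

Lemma n2_wt_inj k l : n2_wt k = n2_wt l ->
  n2_par k = n2_par l -> n2_wt k != 0 -> k = l.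
Proof.
have H m n : - half F m = - n%:~R -> False.
  by move=> /oppr_inj/eqP; apply/negP/half_neq_int.
case: k => [m|m|m|m|]; case: l => [n|n|n|n|] //=; rewrite ?eqxx //.
all: try by move=> /oppr_inj/intr_inj ->.
all: try by move=> /oppr_inj/half_inj ->.
all: try by move=> /H.
all: try by move=> /esym/H.
all: by move=> ->; rewrite eqxx.
Qed.

(** L_{-n} serves for L_n and G^1_n. In half-integral weight r there is no L_{-r}, so J_{-r} serves
    for J_r, with bracket -(r/3) c, and G^2_{-r} for G^2_r, with L_0-coefficient 2. *)
Lemma n2_wt_dual k : n2_wt k != 0 ->
  exists l, weight0 n2_wt (n2_table e l k) /\ n2_table e l k != 0.
Proof.
case: k => [n|n|n|n|] /=; rewrite ?eqxx // oppr_eq0 ?intr_eq0 => n0.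
- exists (NL (- n)); rewrite /= addNr; split.
    apply: weight0_add; apply: weight0_scale; apply: weight0_bas => //=.
    by rewrite oppr0.
  apply/eqP => /(congr1 (mcoeff (NL 0))).
  rewrite coef_add !coef_scale !bas_coef coef_zero eqxx mulr1.
  case: (NC =P NL 0) => // _; rewrite mulr0 addr0 => /eqP; rewrite intr_eq0.
  by move: n0; lia.
(* Index n stands for r = n + 1/2, so -r has index -n - 1. *)
- exists (NJ (- n - 1)); rewrite /= addrAC subrK addNr eqxx mulr1; split.
    by apply: weight0_scale; apply: weight0_bas.
  by rewrite bas_neq0 // mulf_neq0 ?half_neq0 ?invr_eq0 ?pnatr_eq0.
- exists (NL (- n)); rewrite /= addNr; split.
    by apply: weight0_scale; apply: weight0_bas => //=; rewrite oppr0.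
  apply: bas_neq0.
  have -> : (- n)%:~R / 2 - n%:~R = - (3 / 2) * n%:~R :> F by field.
  by rewrite !mulf_neq0 ?oppr_eq0 ?intr_eq0 ?mulf_neq0 ?invr_eq0 ?pnatr_eq0.
exists (NG2 (- n - 1)); rewrite /= addrAC subrK addNr; split.
  apply: weight0_add; apply: weight0_scale; apply: weight0_bas => //=.
  by rewrite oppr0.
apply/eqP => /(congr1 (mcoeff (NL 0))).
rewrite coef_add !coef_scale !bas_coef coef_zero eqxx mulr1.
case: (NC =P NL 0) => // _; rewrite mulr0 addr0 => /eqP.
by rewrite pnatr_eq0.
Qed.

Definition n2_of_h (k : h_index) : n2_index :=
  match k with HG => NG1 0 | HL => NL 0 | HC => NC end.

Lemma n2_of_h_inj : injective n2_of_h. Proof. by do 2!case. Qed.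

Lemma n2_of_h_wt k : n2_wt k = 0 -> exists j, k = n2_of_h j.
Proof.
case: k => [n|n|n|n|] /=; last by exists HC.
all: move=> /eqP; rewrite oppr_eq0 ?intr_eq0 ?(negPf (half_neq0 _ _)) //.
  by move=> /eqP ->; exists HL.
by move=> /eqP ->; exists HG.
Qed.

(** Indices 0 and -1 encode r = 1/2 and r = -1/2. The odd vector is H_r = [G^1_0, J_r] = -i G^2_r;
    its scalar is why the values are vectors and not indices. *)
Definition n2_of_mod (s j : bool) : M :=
  let k : int := if s then -1 else 0 in
  if j then - 'i *: e (NG2 k) else e (NJ k).

Lemma n2_gen (S : M -> Prop) :
  (forall a x y, S x -> S y -> S (a *: x + y)) ->
  (forall x y, S x -> S y -> S (br x y)) ->
  (forall k, S (e (n2_of_h k))) -> (forall s j, S (n2_of_mod s j)) ->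
  forall x, S x.
Proof.
move=> Sl Sb Sh Sm.
have SC : S (e NC) := Sh HC.
have SJ s : S (e (NJ (if s then -1 else 0))) := Sm s false.
have SG12 s n : S (e (NG1 n)) -> S (e (NG2 (n + if s then -1 else 0))).
  by move=> /(Sb _ _ (SJ s)); rewrite n2_br /=; apply: (subspaceZ_inv Sl).
have SG21 s n : S (e (NG2 n)) -> S (e (NG1 ((if s then -1 else 0) + n + 1))).
  move=> /(Sb _ _ (SJ s)); rewrite n2_br /=; apply: (subspaceZ_inv Sl).
  by rewrite oppr_eq0.
have SG1 n : S (e (NG1 n)).
  (* Two applications of J_{1/2}, or of J_{-1/2}, pass through G^2 and shift the index of G^1 by
     one. *)
  elim: n => [|n IH|n IH]; first exact: (Sh HG).
    have := SG21 false _ (SG12 false _ IH).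
    by have -> : 0 + (n%:Z + 0) + 1 = n.+1%:Z by lia.
  have := SG21 true _ (SG12 true _ IH).
  by have -> : -1 + (- n%:Z + -1) + 1 = - n.+1%:Z by lia.
have SG2 n : S (e (NG2 n)) by have := SG12 false _ (SG1 n); rewrite addr0.
apply: (@free_closed F n2_index) => //; first exact: subspace0 SC.
case=> [n|n|||] //.
  have := Sb _ _ (SG1 n) (SG1 0); rewrite n2_br /= addr0.
  move=> /(subspaceD_inv Sl SC); apply: (subspaceZ_inv Sl).
  by rewrite pnatr_eq0.
(* [G^1_0, G^2_r] = -i r J_r, and r is a half-integer, hence nonzero. *)
have := Sb _ _ (SG1 0) (SG2 n); rewrite n2_br /= !add0r; apply: (subspaceZ_inv Sl).
by rewrite mulf_neq0 // oppr_eq0 half_neq0.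
Qed.

(** The signs of [AN2_pair] come from the factor -i in H_r, through the relation [ii].
    [H_{1/2}, H_{-1/2}] has no central term because r^2 - 1/4 vanishes at r = 1/2. *)
Lemma n2_iso : lsa_iso (galg (A_N2 F)) M.
Proof.
apply: (@rank1_iso F M (fun k => e (n2_of_h k)) n2_of_mod).
- by case; rewrite /homog /= free_prj_bas.
- by move=> s []; rewrite /homog /n2_of_mod ?prjZ [prj _ _]free_prj_bas.
- by move=> k k'; rewrite n2_br; apply/malgP => z; case: k; case: k' => /=;
    coef_simpl; rewrite /half; field.
- by move=> k s j; rewrite /n2_of_mod; case: j; rewrite ?brZr n2_br;
    apply/malgP => z; case: k; case: s;
    rewrite /AN2_a /AN2_b /=; coef_simpl; rewrite /half; field: ii.
- by move=> i j; rewrite /n2_of_mod; case: i; case: j; rewrite ?(brZr, brZl) n2_br;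
    apply/malgP => z; rewrite /=; coef_simpl; rewrite /half; field: ii.
- move=> x; apply: lin_bas_inj; exact: n2_of_h_inj.
- exact: n2_gen.
move=> J J0; apply: (weight0_ideal_eq0 n2_wtE n2_wt_inj n2_wt_dual).
move=> x /(weight0_lin n2_of_h_inj n2_of_h_wt) [y ->] /J0 ->.
exact: lin_zero.
Qed.

End TwistedN2.

Theorem proposition3p3 (R : realType) :
  lsa_iso (galg (A_R R[i])) (ramond R[i]) /\
  lsa_iso (galg (A_N2 R[i])) (twistedN2 R[i]).
Proof. by split; [exact: ramond_iso|exact: n2_iso]. Qed.
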